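(* Let $(M,g)$ be a four-dimensional spacetime. (i) If $(M,g)$ is non-conformally flat, in the sense that its Weyl tensor $C_{abcd}$ is non-zero at every point, then $$\nabla_{[a}\nabla_{b]}C_{cdef}=0 \quad\Longleftrightarrow\quad \nabla_{[a}\nabla_{b]}R_{cdef}=0,$$ i.e. $(M,g)$ is conformally semi-symmetric if and only if it is semi-symmetric. (ii) Furthermore, every semi-symmetric spacetime is, at each point, of Petrov type $\mathbf{D}$, $\mathbf{N}$ or $\mathbf{O}$.
   Context: A spacetime is a smooth 4-dimensional Lorentzian manifold $(M,g)$, with Levi-Civita connection $\nabla$, Riemann tensor $R_{abcd}$ and Weyl tensor $C_{abcd}$ (the totally trace-free part of the Riemann tensor). Square brackets enclosing indices denote antisymmetrization. The spacetime is called semi-symmetric if $\nabla_{[a}\nabla_{b]}R_{cdef}=0$ and conformally semi-symmetric if $\nabla_{[a}\nabla_{b]}C_{cdef}=0$. The Petrov type at a point is the usual algebraic type of the Weyl tensor there. In terms of the totally symmetric Weyl spinor $\Psi_{ABCD}$, written as a symmetrized product of four one-index spinors (principal spinors): type $\mathbf{O}$ means $\Psi_{ABCD}=0$ (vanishing Weyl tensor); type $\mathbf{N}$ means $\Psi_{ABCD}\neq 0$ and all four principal spinors are proportional; type $\mathbf{D}$ means $\Psi_{ABCD}\neq0$ and the principal spinors coincide, up to proportionality, in two distinct pairs. *)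

(* Defs.v *)
From mathcomp Require Import all_boot all_order all_algebra all_fingroup.
From mathcomp Require Import all_classical all_reals all_analysis.
From mathcomp Require Import complex.

Set Implicit Arguments.
Unset Strict Implicit.
Unset Printing Implicit Defensive.

Import Order.TTheory GRing.Theory Num.Theory.
Import numFieldNormedType.Exports.

Local Open Scope classical_set_scope.
Local Open Scope ring_scope.

Section SmoothFunctions.
Variable R : realType.
Implicit Types (f : 'rV[R]_4 -> R) (a : 'I_4) (x : 'rV[R]_4).

Definition pderiv a f : 'rV[R]_4 -> R := fun x => 'D_(delta_mx 0 a) f x.

(* C^oo on U: every iterated partial derivative, of order zero included, is
   (Frechet) differentiable at every point of U. *)
Definition smooth_on (U : set 'rV[R]_4) f :=
  forall (s : seq 'I_4) x, U x -> differentiable (foldr pderiv f s) x.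

End SmoothFunctions.

(* A chart is a homeomorphism between an open subset [dom] of M and an open
   subset [cod] of R^4; outside these sets [coord] and [icoord] are junk. *)
Record chart (R : realType) (M : topologicalType) := Chart {
  dom : set M;
  cod : set 'rV[R]_4;
  coord : M -> 'rV[R]_4;
  icoord : 'rV[R]_4 -> M;
  dom_open : open dom;
  cod_open : open cod;
  coord_cod : forall p, dom p -> cod (coord p);
  icoord_dom : forall x, cod x -> dom (icoord x);
  coordK : forall p, dom p -> icoord (coord p) = p;
  icoordK : forall x, cod x -> coord (icoord x) = x;
  coord_continuous : {within dom, continuous coord};
  icoord_continuous : {within cod, continuous icoord} }.

Section Transition.
Variables (R : realType) (M : topologicalType).
Implicit Types c : chart R M.

Definition transition c c' : 'rV[R]_4 -> 'rV[R]_4 :=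
  fun x => coord c' (icoord c x).

Definition overlap c c' : set 'rV[R]_4 :=
  [set x | cod c x /\ dom c' (icoord c x)].

End Transition.

(* The components of the metric at a point form a matrix of signature
   (+,-,-,-). *)
Definition minkowski (R : realType) : 'M[R]_4 :=
  diag_mx (\row_(j < 4) (if j == 0 then 1 else -1)).

Definition lorentzian (R : realType) (G : 'M[R]_4) :=
  exists2 P : 'M[R]_4, P \in unitmx & P *m G *m P^T = minkowski R.

(* A smooth 4-manifold with a smooth Lorentzian metric.  [metric c x a b] is
   the component g_ab, in the chart c, at the point of coordinates x; it is
   only meaningful for x in [cod c].  In MathComp's row-vector convention the
   entry (a, b) of a Jacobian is the derivative of the b-th component in the
   direction a, so that [metric_transform] is the usual transformation law of a
   tensor of type (0,2). *)
Record spacetime (R : realType) (M : topologicalType) := Spacetime {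
  M_hausdorff : hausdorff_space M;
  M_second_countable : @second_countable M;
  atlas : set (chart R M);
  atlas_cover : forall p : M, exists2 c, atlas c & dom c p;
  atlas_smooth : forall c c', atlas c -> atlas c' ->
    forall j : 'I_4, smooth_on (overlap c c') (fun x => transition c c' x 0 j);
  metric : chart R M -> 'rV[R]_4 -> 'M[R]_4;
  metric_smooth : forall c, atlas c ->
    forall a b, smooth_on (cod c) (fun x => metric c x a b);
  metric_sym : forall c x, atlas c -> cod c x -> (metric c x)^T = metric c x;
  metric_lorentzian : forall c x, atlas c -> cod c x -> lorentzian (metric c x);
  metric_transform : forall c c' x, atlas c -> atlas c' -> overlap c c' x ->
    let J := jacobian (transition c c') x in
    metric c x = J *m metric c' (transition c c' x) *m J^T }.

Section Curvature.
Variables (R : realType) (g : 'rV[R]_4 -> 'M[R]_4).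
Local Notation field := ('rV[R]_4 -> R).
Implicit Types (a b c d e m : 'I_4) (x : 'rV[R]_4).

Definition lower a b : field := fun x => g x a b.
Definition upper a b : field := fun x => invmx (g x) a b.

(* Gamma^m_ab, for the Levi-Civita connection *)
Definition christoffel m a b : field := fun x =>
  2^-1 * \sum_e upper m e x *
    (pderiv a (lower e b) x + pderiv b (lower e a) x - pderiv e (lower a b) x).

(* R^a_bcd, with (nabla_c nabla_d - nabla_d nabla_c) V^a = R^a_bcd V^b *)
Definition riemann_up a b c d : field := fun x =>
  pderiv c (christoffel a d b) x - pderiv d (christoffel a c b) x
  + \sum_e (christoffel a c e x * christoffel e d b x
            - christoffel a d e x * christoffel e c b x).

Definition riemann a b c d : field := fun x =>
  \sum_e lower a e x * riemann_up e b c d x.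

Definition ricci b d : field := fun x => \sum_a riemann_up a b a d x.

Definition scalar_curvature : field := fun x =>
  \sum_b \sum_d upper b d x * ricci b d x.

(* the totally trace-free part of the Riemann tensor, in dimension 4 *)
Definition weyl a b c d : field := fun x =>
  riemann a b c d x
  - 2^-1 * (lower a c x * ricci b d x - lower a d x * ricci b c x
            - lower b c x * ricci a d x + lower b d x * ricci a c x)
  + 6^-1 * scalar_curvature x
         * (lower a c x * lower b d x - lower a d x * lower b c x).

(* components of a covariant tensor field of rank k *)
Definition tensor k := k.-tuple 'I_4 -> field.

Definition tensor4 (T : 'I_4 -> 'I_4 -> 'I_4 -> 'I_4 -> field) : tensor 4 :=
  fun s => T (tnth s 0) (tnth s 1) (tnth s 2) (tnth s 3).

(* (nabla T)_{a s_1 .. s_k} = nabla_a T_{s_1 .. s_k}: the new index comes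
   first. *)
Definition nabla k (T : tensor k) : tensor k.+1 := fun as_ x =>
  let a := thead as_ in
  let s := [tuple of behead as_] in
  pderiv a (T s) x
  - \sum_(j < k) \sum_m christoffel m a (tnth s j) x *
      T [tuple (if l == j then m else tnth s l) | l < k] x.

(* nabla_[a nabla_b] T_s *)
Definition alt_nabla2 k (T : tensor k) a b (s : k.-tuple 'I_4) : field :=
  fun x => 2^-1 * (nabla (nabla T) [tuple of a :: b :: s] x
                   - nabla (nabla T) [tuple of b :: a :: s] x).

End Curvature.

Section Spinors.
Variable R : realType.
Local Notation C := R[i].

Definition eps (A B : 'I_2) : C :=
  if (A == 0) && (B == 1) then 1 else if (A == 1) && (B == 0) then -1 else 0.

(* The Infeld-van der Waerden symbols sigma^a_{AA'} of a spin frame at a point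
   where the metric is G: g_ab sigma^a_{AA'} sigma^b_{BB'} = eps_AB eps_A'B' and
   sigma is Hermitian.  Thus (sigma_00', sigma_11', sigma_01', sigma_10') is a
   Newman-Penrose null tetrad (l, n, m, conjugate of m). *)
Definition infeld_vdw (G : 'M[R]_4) (sigma : 'I_2 -> 'I_2 -> 'rV[C]_4) :=
  (forall A A' B B',
     \sum_a \sum_b (G a b)%:C%C * sigma A A' 0 a * sigma B B' 0 b
       = eps A B * eps A' B') /\
  (forall A A' a, (sigma A A' 0 a)^* = sigma A' A 0 a).

(* Psi_ABCD = (1/4) eps^A'B' eps^C'D' C_{AA'BB'CC'DD'}, i.e. the Psi of
   C_abcd = Psi_ABCD eps_A'B' eps_C'D' + complex conjugate *)
Definition weyl_spinor (W : 'I_4 -> 'I_4 -> 'I_4 -> 'I_4 -> R)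
    (sigma : 'I_2 -> 'I_2 -> 'rV[C]_4) (A B C D : 'I_2) : R[i] :=
  4^-1 * \sum_A' \sum_B' \sum_C' \sum_D' eps A' B' * eps C' D' *
    \sum_a \sum_b \sum_c \sum_d (W a b c d)%:C%C *
      sigma A A' 0 a * sigma B B' 0 b * sigma C C' 0 c * sigma D D' 0 d.

(* k0_(A k1_B k2_C k3_D) *)
Definition sym_prod (k : 'I_4 -> 'rV[C]_2) (A B C D : 'I_2) : R[i] :=
  (4`!%:R)^-1 * \sum_(s : 'S_4) \prod_i k i 0 (tnth [tuple A; B; C; D] (s i)).

Definition principal_spinors (Psi : 'I_2 -> 'I_2 -> 'I_2 -> 'I_2 -> C)
    (k : 'I_4 -> 'rV[C]_2) :=
  forall A B C D, Psi A B C D = sym_prod k A B C D.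

Definition proportional (k l : 'rV[C]_2) := exists2 z : C, z != 0 & l = z *: k.

Definition spinor_type_O (Psi : 'I_2 -> 'I_2 -> 'I_2 -> 'I_2 -> C) :=
  forall A B C D, Psi A B C D = 0.

Definition spinor_type_N (Psi : 'I_2 -> 'I_2 -> 'I_2 -> 'I_2 -> C) :=
  ~ spinor_type_O Psi /\
  exists2 k, principal_spinors Psi k & forall i j, proportional (k i) (k j).

Definition spinor_type_D (Psi : 'I_2 -> 'I_2 -> 'I_2 -> 'I_2 -> C) :=
  ~ spinor_type_O Psi /\
  exists2 k, principal_spinors Psi k &
    [/\ proportional (k 0) (k 1), proportional (k 2) (k 3)
      & ~ proportional (k 0) (k 2)].

End Spinors.

Section Spacetime.
Variables (R : realType) (M : topologicalType) (S : spacetime R M).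
Implicit Types (p : M) (c : chart R M).

(* Vanishing of a tensor, and the Petrov type, do not depend on the chart used
   to compute components; the conditions below are required in every chart of
   the atlas. *)
Definition semi_symmetric :=
  forall p c, atlas S c -> dom c p -> forall a b s,
    alt_nabla2 (metric S c) (tensor4 (riemann (metric S c))) a b s (coord c p)
      = 0.

Definition conformally_semi_symmetric :=
  forall p c, atlas S c -> dom c p -> forall a b s,
    alt_nabla2 (metric S c) (tensor4 (weyl (metric S c))) a b s (coord c p)
      = 0.

Definition weyl_neq0 p :=
  forall c, atlas S c -> dom c p ->
    exists i j k l, weyl (metric S c) i j k l (coord c p) != 0.

(* The Weyl spinor at p, in the chart c, with respect to some spin frame, is of
   type T.  A change of spin frame acts on Psi through SL(2,C), up to complex
   conjugation when it reverses the orientation, so the choice of the frame is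
   immaterial. *)
Definition petrov_in
    (T : ('I_2 -> 'I_2 -> 'I_2 -> 'I_2 -> R[i]) -> Prop) c p :=
  exists2 sigma, infeld_vdw (metric S c (coord c p)) sigma &
    T (weyl_spinor (fun i j k l => weyl (metric S c) i j k l (coord c p)) sigma).

Definition petrov_D := petrov_in (@spinor_type_D R).
Definition petrov_N := petrov_in (@spinor_type_N R).
Definition petrov_O := petrov_in (@spinor_type_O R).

End Spacetime.

(* Main.v *)
From mathcomp Require Import all_boot all_order all_algebra all_fingroup.
From mathcomp Require Import all_classical all_reals all_analysis.
From mathcomp Require Import complex ring lra.
Require Import Defs.

Set Implicit Arguments.
Unset Strict Implicit.
Unset Printing Implicit Defensive.

Import Order.TTheory GRing.Theory Num.Theory.
Import numFieldNormedType.Exports.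

Local Open Scope classical_set_scope.
Local Open Scope ring_scope.

(** Everything happens at one point, in one chart.  By the Ricci identity,
    nabla_[a nabla_b] T is, up to a factor, the infinitesimal action on T of
    the curvature endomorphism R_ab, with entries R^m_cab ([ricci_identity],
    [alt_nabla2_tensor4]).  These endomorphisms lie in so(1,3), as they kill
    the metric ([riemann_anti12]), so both conditions of the theorem are
    algebraic: all the R_ab kill the Weyl tensor W, respectively the Riemann tensor.

    If they kill the Riemann tensor they kill the Ricci tensor, a metric
    contraction of it, hence W ([kills4_weyl]).

    The spinor picture takes care of the rest.  A real A in so(1,3) is a
    symmetric spinor a_AB, that is a binary quadratic form, and W is a binary
    quartic form Psi; A kills W only if the Poisson bracket of a and Psi is zero
    ([so_act_kills_quartic]).  For a <> 0 this forces Psi = c a^2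
    ([kills_quartic_square]).  Two consequences follow.

    Types.  If Psi <> 0 then W <> 0, so some R_ab is not zero, and Psi = c a^2
    with c <> 0 for the form a of that endomorphism.  Factoring a into two
    linear forms shows the four principal spinors in two pairs: type D if the
    two factors of a are independent, type N otherwise ([square_type]).

    Equivalence.  If Psi <> 0, two forms which both bracket to zero with Psi
    are proportional ([kills_quartic_proportional]), so all the R_ab commute
    ([curv_comm]).  By the pair symmetry R_abcd = R_cdab, the action of R_ab on
    the Riemann tensor is a sum of two terms, each expressing a commutator with
    some R_cd; it vanishes ([curv_kills_riemann]). *)

(** * Partial derivatives and smooth functions *)

(** Differentiability at a point is a local property. *)
Lemma near_differentiable (R : numFieldType) (V W : normedModType R)
  (f g : V -> W) x :
  {near x, f =1 g} -> differentiable f x -> differentiable g x.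
Proof.
move=> fg df.
have fgx : f x = g x := nbhs_singleton fg.
have e : g \o shift x = cst (g x) + 'd f x +o_ 0 id.
  apply/eqaddoP => _/posnumP[e].
  have /eqaddoP /(_ _ [gt0 of e%:num]) H := diff_locally df.
  have fgs : \forall h \near (0 : V), f (h + x) = g (h + x).
    rewrite (near_shift x) sub0r; near=> y; rewrite /= subrK.
    by near: y; exact: fg.
  near=> h.
  have : `|(f \o shift x - (cst (f x) + 'd f x)) h| <= e%:num * `|h|.
    near: h; exact: H.
  rewrite /= !fctE /=.
  suff -> : f (h + x) = g (h + x) by rewrite fgx.
  by near: h.
apply/diff_locallyP; have cd : continuous ('d f x) by exact: diff_continuous.
by rewrite (diff_unique cd e).
Unshelve. all: by end_near. Qed.

Section PartialDerivatives.
Variable R : realType.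
Implicit Types (f g h : 'rV[R]_4 -> R) (a : 'I_4) (x : 'rV[R]_4) (U :
  set 'rV[R]_4).

Lemma near_pderiv f g x a : {near x, f =1 g} -> pderiv a f x = pderiv a g x.
Proof. by move=> fg; apply: near_eq_derive. Qed.

Lemma pderivD f g x a : differentiable f x -> differentiable g x ->
  pderiv a (fun y => f y + g y) x = pderiv a f x + pderiv a g x.
Proof. by move=> df dg; apply: deriveD; apply: diff_derivable. Qed.

Lemma pderivN f x a : differentiable f x ->
  pderiv a (fun y => - f y) x = - pderiv a f x.
Proof. by move=> df; apply: deriveN; apply: diff_derivable. Qed.

Lemma pderivM f g x a : differentiable f x -> differentiable g x ->
  pderiv a (fun y => f y * g y) x = pderiv a f x * g x + f x * pderiv a g x.
Proof.
move=> df dg; rewrite /pderiv (@deriveM _ _ f g); try exact: diff_derivable.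
by rewrite addrC /GRing.scale /= [g x * _]mulrC.
Qed.

Lemma pderivV f x a : f x != 0 -> differentiable f x ->
  pderiv a (fun y => (f y)^-1) x = - (pderiv a f x) * (f x)^-1 * (f x)^-1.
Proof.
move=> f0 df; rewrite /pderiv deriveV //; last exact: diff_derivable.
by rewrite /GRing.scale /= expr2 invfM; ring.
Qed.

Lemma is_derive_line t0 (u x : 'rV[R]_4) f : differentiable f (x + t0 *: u) ->
  is_derive t0 1 (fun t : R => f (x + t *: u)) ('D_u f (x + t0 *: u)).
Proof.
move=> df.
have H : derivable f (x + t0 *: u) u by exact: diff_derivable.
have e : (fun h : R => h^-1 *: (((fun t => f (x + t *: u)) \o shift t0) h%:A
            - f (x + t0 *: u)))
       = (fun h : R => h^-1 *: ((f \o shift (x + t0 *: u)) (h *: u)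
            - f (x + t0 *: u))).
  apply/funext => h /=; rewrite [h%:A]mulr1 scalerDl [_ *: u + _]addrC addrA.
  by congr (_ *: (f _ - _)); rewrite addrC.
by split; rewrite /derivable /derive /= e.
Qed.

Lemma mean_value_from0 (f df : R -> R) (h : R) : 0 < h ->
  (forall t : R, t \in `[0, h]%R -> is_derive t 1 f (df t)) ->
  exists2 c, c \in `[0, h]%R & f h - f 0 = df c * h.
Proof.
move=> h0 H.
have A : forall t : R, t \in `]0, h[%R -> is_derive t 1 f (df t).
  by move=> t ti; apply: H; apply: subset_itv_oo_cc.
have B : {within `[0, h], continuous f}.
  by apply: derivable_within_continuous => t /H[].
have [c ci e] := MVT h0 A B.
by exists c; [exact: subset_itv_oo_cc|rewrite e subr0].
Qed.

(** The mean value theorem applied along [u] and then along [v]: the second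
    difference of [f] over a parallelogram of side [h] is [h ^+ 2] times a mixed
    second derivative at some point of it. *)
Lemma second_difference f (x u v : 'rV[R]_4) (h : R) : 0 < h ->
  (forall s t, s \in `[0, h]%R -> t \in `[0, h]%R ->
    differentiable f (x + t *: v + s *: u)
    /\ differentiable ('D_u f) (x + s *: u + t *: v)) ->
  exists s t, [/\ s \in `[0, h]%R, t \in `[0, h]%R &
   f (x + h *: v + h *: u) - f (x + h *: u) - (f (x + h *: v) - f x)
    = 'D_v ('D_u f) (x + s *: u + t *: v) * h * h].
Proof.
move=> h0 H.
have i0 : (0 : R) \in `[0, h]%R by rewrite in_itv /= lexx ltW.
have ih : h \in `[0, h]%R by rewrite in_itv /= lexx ltW.
have [|s si es] :=
  @mean_value_from0 (fun s => f (x + h *: v + s *: u) - f (x + s *: u))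
  (fun s => 'D_u f (x + h *: v + s *: u) - 'D_u f (x + s *: u)) h h0.
  move=> s si; apply: is_deriveB; apply: is_derive_line.
    by have [] := H s h si ih.
  by have [] := H s 0 si i0; rewrite scale0r addr0.
have [|t ti et] := @mean_value_from0 (fun t => 'D_u f (x + s *: u + t *: v))
  (fun t => 'D_v ('D_u f) (x + s *: u + t *: v)) h h0.
  by move=> t ti; apply: is_derive_line; have [] := H s t si ti.
exists s, t; split => //.
move: es; rewrite scale0r !addr0 => ->; rewrite -et scale0r addr0.
by congr (('D_u f _ - _) * _); rewrite addrAC.
Qed.

Lemma dist_halves (p q m e : R) :
  `|p - m| < e / 2 -> `|q - m| < e / 2 -> `|p - q| <= e.
Proof.
move=> pm qm; rewrite -[p](subrK m) -addrA (le_trans (ler_normD _ _)) //.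
by rewrite [e]splitr -[m - q]opprB normrN; apply: lerD; apply: ltW.
Qed.

(** Symmetry of second derivatives: both mixed derivatives, which are continuous
    at [x], are limits of the same second difference quotient. *)
Lemma schwarz_derive U f (x u v : 'rV[R]_4) : open U -> U x ->
  (forall y, U y -> [/\ differentiable f y, differentiable ('D_u f) y &
     differentiable ('D_v f) y]) ->
  {for x, continuous ('D_v ('D_u f))} -> {for x, continuous ('D_u ('D_v f))} ->
  'D_v ('D_u f) x = 'D_u ('D_v f) x.
Proof.
move=> oU Ux dU cF cG; apply/eqP; rewrite -subr_eq0 -normr_eq0.
apply/eqP/le_anti; rewrite normr_ge0 andbT; apply/ler_addgt0Pl => e e0.
rewrite addr0; have e2 : 0 < e / 2 by rewrite divr_gt0.
have nU : \forall y \near x, U y by exact: open_nbhs_nbhs.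
have nF : \forall y \near x, `|'D_v ('D_u f) x - 'D_v ('D_u f) y| < e / 2.
  have /cvgrPdist_lt/(_ _ e2) H := cF; exact: H.
have nG : \forall y \near x, `|'D_u ('D_v f) x - 'D_u ('D_v f) y| < e / 2.
  have /cvgrPdist_lt/(_ _ e2) H := cG; exact: H.
have [r /= r0 B] : exists2 r : R, 0 < r & forall y, `|y - x| < r ->
  [/\ U y, `|'D_v ('D_u f) x - 'D_v ('D_u f) y| < e / 2 &
     `|'D_u ('D_v f) x - 'D_u ('D_v f) y| < e / 2].
  have /nbhs_normP[r /= r0 B] : \forall y \near x,
    [/\ U y, `|'D_v ('D_u f) x - 'D_v ('D_u f) y| < e / 2 &
     `|'D_u ('D_v f) x - 'D_u ('D_v f) y| < e / 2].
    by apply: filterS3 nU nF nG => y ? ? ?; split.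
  by exists r => // y yx; apply: B; rewrite /ball_ /= distrC.
pose h := r / (1 + `|u| + `|v|).
have n0 : 0 < 1 + `|u| + `|v| by rewrite -addrA ltr_wpDr // addr_ge0.
have h0 : 0 < h by rewrite divr_gt0.
have small s t : s \in `[0, h]%R -> t \in `[0, h]%R ->
  `|(x + s *: u + t *: v) - x| < r.
  rewrite !in_itv /= => /andP[s0 sh] /andP[t0 th].
  have -> : x + s *: u + t *: v - x = s *: u + t *: v.
    by apply/eqP; rewrite subr_eq [eqbRHS]addrC addrA.
  rewrite (le_lt_trans (ler_normD _ _)) //.
  rewrite !normrZ !ger0_norm //.
  have -> : r = h * (1 + `|u| + `|v|) by rewrite /h divfK // gt_eqF.
  have := ler_wpM2r (normr_ge0 u) sh; have := ler_wpM2r (normr_ge0 v) th.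
  by rewrite !mulrDr mulr1; lra.
have [|s [t [si ti e1]]] := @second_difference f x u v h h0.
  move=> s t si ti; split; last by have [/dU[]] := B _ (small _ _ si ti).
  by rewrite addrAC; have [/dU[]] := B _ (small _ _ si ti).
have [|s' [t' [si' ti' e2']]] := @second_difference f x v u h h0.
  move=> s' t' si' ti'; split.
    by have [/dU[]] := B _ (small _ _ ti' si').
  by rewrite addrAC; have [/dU[]] := B _ (small _ _ ti' si').
have ee : 'D_v ('D_u f) (x + s *: u + t *: v)
  = 'D_u ('D_v f) (x + s' *: v + t' *: u).
  have hn : h * h != 0 by rewrite mulf_neq0 // gt_eqF.
  have swap (A1 B1 C D : R) : A1 - B1 - (C - D) = A1 - C - (B1 - D) by ring.
  rewrite swap [x + h *: v + _]addrAC in e1.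
  rewrite -mulrA in e1; rewrite -mulrA in e2'.
  by apply: (mulIf hn); exact: etrans (esym e1) e2'.
have [_ b1 _] := B _ (small _ _ si ti).
have [_ _ b2] := B _ (small _ _ ti' si').
rewrite addrAC in b2.
rewrite ee in b1.
exact: dist_halves b1 b2.
Qed.

Section Smooth.
Variable U : set 'rV[R]_4.
Hypothesis oU : open U.

Lemma near_open x (P : 'rV[R]_4 -> Prop) : U x -> (forall y, U y -> P y) ->
  \forall y \near x, P y.
Proof. by move=> Ux H; near=> y; apply: H; near: y; exact: open_nbhs_nbhs.
Unshelve. all: by end_near. Qed.

Lemma eq_pderiv f g x a : U x -> (forall y, U y -> f y = g y) ->
  pderiv a f x = pderiv a g x.
Proof. by move=> Ux H; apply: near_pderiv; exact: near_open. Qed.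

Lemma foldr_pderiv_eq f g s x : (forall y, U y -> f y = g y) -> U x ->
  foldr (@pderiv R) f s x = foldr (@pderiv R) g s x.
Proof. by move=> H; elim: s x => [|a s IH] x Ux /=;
  [exact: H|exact: eq_pderiv]. Qed.

(** [Ck k f]: the iterated partial derivatives of [f] of order at most [k]
    are differentiable on [U].  The bound on the order makes the stability
    properties provable by induction, by means of [CkS]. *)
Definition Ck k f := forall s x, (size s <= k)%N -> U x ->
  differentiable (foldr (@pderiv R) f s) x.

Lemma smooth_onP f : smooth_on U f <-> forall k, Ck k f.
Proof. by split=> [H k s x _|H s x]; [exact: H|exact: H (leqnn (size s))]. Qed.

Lemma Ck_eq k f g : (forall y, U y -> f y = g y) -> Ck k f -> Ck k g.
Proof.
move=> H S s x ks Ux; apply: near_differentiable (S s x ks Ux).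
by apply: near_open => // y Uy; exact: foldr_pderiv_eq.
Qed.

Lemma Ck_diff k f x : Ck k f -> U x -> differentiable f x.
Proof. by move=> H Ux; exact: (H [::] x). Qed.

Lemma CkS k f : Ck k.+1 f <->
  (forall x, U x -> differentiable f x) /\ forall a, Ck k (pderiv a f).
Proof.
split=> [H|[H0 H]].
  split=> [x Ux|a s x ks Ux]; first exact: Ck_diff H Ux.
  by rewrite -foldr_rcons; apply: H; rewrite ?size_rcons.
move=> s x; elim/last_ind: s => [_ Ux|s a _]; first exact: H0.
by rewrite size_rcons ltnS foldr_rcons => ks Ux; exact: H.
Qed.

Lemma Ck_W k f : Ck k.+1 f -> Ck k f.
Proof. by move=> H s x ks; apply: H; exact: leqW. Qed.

Lemma CkD k f g : Ck k f -> Ck k g -> Ck k (fun x => f x + g x).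
Proof.
elim: k f g => [|k IH] f g Hf Hg.
  by move=> [|//] x _ Ux /=; apply: differentiableD;
    [exact: Ck_diff Hf Ux|exact: Ck_diff Hg Ux].
have [f0 f1] := (CkS k f).1 Hf; have [g0 g1] := (CkS k g).1 Hg.
apply/CkS; split=> [x Ux|a]; first by apply: differentiableD; auto.
apply: Ck_eq (IH _ _ (f1 a) (g1 a)) => y Uy.
by rewrite pderivD; auto.
Qed.

Lemma CkM k f g : Ck k f -> Ck k g -> Ck k (fun x => f x * g x).
Proof.
elim: k f g => [|k IH] f g Hf Hg.
  by move=> [|//] x _ Ux /=; apply: differentiableM;
    [exact: Ck_diff Hf Ux|exact: Ck_diff Hg Ux].
have [f0 f1] := (CkS k f).1 Hf; have [g0 g1] := (CkS k g).1 Hg.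
apply/CkS; split=> [x Ux|a]; first by apply: differentiableM; auto.
apply: (Ck_eq _ (CkD (IH _ _ (f1 a) (Ck_W Hg)) (IH _ _ (Ck_W Hf) (g1 a)))) =>
  y Uy.
by rewrite pderivM; auto.
Qed.

Lemma CkN k f : Ck k f -> Ck k (fun x => - f x).
Proof.
elim: k f => [|k IH] f Hf.
  by move=> [|//] x _ Ux /=; apply: differentiableN; exact: Ck_diff Hf Ux.
have [f0 f1] := (CkS k f).1 Hf.
apply/CkS; split=> [x Ux|a]; first by apply: differentiableN; auto.
apply: (Ck_eq _ (IH _ (f1 a))) => y Uy.
by rewrite pderivN; auto.
Qed.

Lemma CkV k f : (forall x, U x -> f x != 0) -> Ck k f ->
  Ck k (fun x => (f x)^-1).
Proof.
move=> fn0; elim: k => [|k IH] Hf.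
  move=> [|//] x _ Ux /=; apply: differentiableV;
    [exact: Ck_diff Hf Ux|exact: fn0].
have [f0 f1] := (CkS k f).1 Hf.
apply/CkS; split=> [x Ux|a]; first by apply: differentiableV; auto.
have I := IH (Ck_W Hf).
apply: (Ck_eq _ (CkM (CkM (CkN (f1 a)) I) I)) => y Uy.
by rewrite pderivV; auto.
Qed.

Lemma Ck_cst k c : Ck k (fun=> c).
Proof.
elim: k c => [|k IH] c.
  by move=> [|//] x _ Ux /=; exact: differentiable_cst.
apply/CkS; split=> [x Ux|a]; first exact: differentiable_cst.
by apply: (Ck_eq _ (IH 0)) => y Uy; rewrite /pderiv derive_cst.
Qed.

Lemma smoothD f g : smooth_on U f -> smooth_on U g ->
  smooth_on U (fun x => f x + g x).
Proof. by move=> /smooth_onP Hf /smooth_onP Hg; apply/smooth_onP => k;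
  exact: CkD. Qed.

Lemma smoothM f g : smooth_on U f -> smooth_on U g ->
  smooth_on U (fun x => f x * g x).
Proof. by move=> /smooth_onP Hf /smooth_onP Hg; apply/smooth_onP => k;
  exact: CkM. Qed.

Lemma smoothN f : smooth_on U f -> smooth_on U (fun x => - f x).
Proof. by move=> /smooth_onP Hf; apply/smooth_onP => k; exact: CkN. Qed.

Lemma smoothB f g : smooth_on U f -> smooth_on U g ->
  smooth_on U (fun x => f x - g x).
Proof. by move=> Hf Hg; apply: smoothD => //; exact: smoothN. Qed.

Lemma smoothV f : (forall x, U x -> f x != 0) -> smooth_on U f ->
  smooth_on U (fun x => (f x)^-1).
Proof. by move=> f0 /smooth_onP Hf; apply/smooth_onP => k; exact: CkV. Qed.

Lemma smooth_cst c : smooth_on U (fun=> c).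
Proof. by apply/smooth_onP => k; exact: Ck_cst. Qed.

Lemma smooth_eq f g : (forall y, U y -> f y = g y) -> smooth_on U f ->
  smooth_on U g.
Proof. by move=> e /smooth_onP Hf; apply/smooth_onP => k;
  exact: Ck_eq (Hf k). Qed.

Lemma smooth_pderiv f a : smooth_on U f -> smooth_on U (pderiv a f).
Proof. by move=> Hf s x Ux; rewrite -foldr_rcons; exact: Hf. Qed.

Lemma smooth_diff f x : smooth_on U f -> U x -> differentiable f x.
Proof. by move=> H; exact: (H [::]). Qed.

Lemma smooth_sum (I : Type) (r : seq I) (F : I -> 'rV[R]_4 -> R) :
  (forall i, smooth_on U (F i)) -> smooth_on U (fun x => \sum_(i <- r) F i x).
Proof.
move=> H; elim: r => [|i r IH].
  by apply: smooth_eq (smooth_cst 0) => y _; rewrite big_nil.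
by apply: smooth_eq (smoothD (H i) IH) => y _; rewrite big_cons.
Qed.

Lemma smooth_prod (I : Type) (r : seq I) (F : I -> 'rV[R]_4 -> R) :
  (forall i, smooth_on U (F i)) -> smooth_on U (fun x => \prod_(i <- r) F i x).
Proof.
move=> H; elim: r => [|i r IH].
  by apply: smooth_eq (smooth_cst 1) => y _; rewrite big_nil.
by apply: smooth_eq (smoothM (H i) IH) => y _; rewrite big_cons.
Qed.

Lemma smooth_det n (G : 'rV[R]_4 -> 'M[R]_n) :
  (forall i j, smooth_on U (fun x => G x i j)) ->
    smooth_on U (fun x => \det (G x)).
Proof.
move=> H; rewrite /determinant; apply: smooth_sum => s.
by apply: smoothM; [exact: smooth_cst|exact: smooth_prod].
Qed.

Lemma smooth_invmx (G : 'rV[R]_4 -> 'M[R]_4) :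
  (forall i j, smooth_on U (fun x => G x i j)) ->
  (forall x, U x -> G x \in unitmx) ->
  forall i j, smooth_on U (fun x => invmx (G x) i j).
Proof.
move=> H Gu i j.
apply: (@smooth_eq (fun x => (\det (G x))^-1 * \adj (G x) i j)).
  by move=> y Uy; rewrite /invmx (Gu _ Uy) [RHS]mxE.
apply: smoothM.
  by apply: smoothV; [move=> x /Gu; rewrite unitmxE unitfE|exact: smooth_det].
apply: (@smooth_eq (fun x => (-1) ^+ (j + i) * \det (row' j (col' i (G x))))).
  by move=> y _; rewrite mxE.
apply: smoothM; first exact: smooth_cst.
apply: smooth_det => k l; apply: smooth_eq (H (lift j k) (lift i l)) => y _.
by rewrite !mxE.
Qed.

Lemma pderiv_sum (I : Type) (r : seq I) (F : I -> 'rV[R]_4 -> R) a x : U x ->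
  (forall i, smooth_on U (F i)) ->
  pderiv a (fun y => \sum_(i <- r) F i y) x = \sum_(i <- r) pderiv a (F i) x.
Proof.
move=> Ux H; elim: r => [|i r IH].
  rewrite big_nil (eq_pderiv (g := cst 0) _ Ux) ?/pderiv ?derive_cst // => y _.
  by rewrite big_nil.
rewrite big_cons -IH -pderivD.
- by apply: eq_pderiv => // y _; rewrite big_cons.
- exact: smooth_diff.
- by apply: smooth_diff => //; exact: smooth_sum.
Qed.

Lemma pderivC f a b x : smooth_on U f -> U x ->
  pderiv a (pderiv b f) x = pderiv b (pderiv a f) x.
Proof.
move=> Hf Ux; apply: (@schwarz_derive U) => //.
- by move=> y Uy; split; apply: smooth_diff; rewrite //; apply: smooth_pderiv.
- apply: differentiable_continuous; apply: smooth_diff => //.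
  by apply: smooth_pderiv; apply: smooth_pderiv.
- apply: differentiable_continuous; apply: smooth_diff => //.
  by apply: smooth_pderiv; apply: smooth_pderiv.
Qed.

End Smooth.
End PartialDerivatives.

(** * The Ricci identity and the symmetries of the Riemann tensor *)

Section Tuples.
Variables (T : eqType) (k : nat).
(** The multi-index [s] with its [j]-th index replaced by [m]. *)
Definition tsub (s : k.-tuple T) (j : 'I_k) (m : T) : k.-tuple T :=
  [tuple (if l == j then m else tnth s l) | l < k].

Lemma tnth_tsub s j m i : tnth (tsub s j m) i = if i == j then m else tnth s i.
Proof. by rewrite tnth_mktuple. Qed.

Lemma tsub_tsub s j m n : tsub (tsub s j m) j n = tsub s j n.
Proof. by apply: eq_from_tnth => i; rewrite !tnth_tsub; case: eqP. Qed.

Lemma tsubC s i j m n : i != j -> tsub (tsub s j m) i n = tsub (tsub s i n) j m.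
Proof.
move=> ij; apply: eq_from_tnth => l; rewrite !tnth_tsub.
by case: eqP => // ->; rewrite (negbTE ij).
Qed.
End Tuples.

Lemma tsub_cons0 (T : eqType) k (b m : T) (s : k.-tuple T) :
  tsub [tuple of b :: s] ord0 m = [tuple of m :: s].
Proof.
apply: eq_from_tnth => i; rewrite tnth_tsub; case: (unliftP ord0 i) => [j|] ->.
  by rewrite !tnthS.
by rewrite eqxx.
Qed.

Lemma tsub_consS (T : eqType) k (b m : T) (s : k.-tuple T) j :
  tsub [tuple of b :: s] (lift ord0 j) m = [tuple of b :: tsub s j m].
Proof.
apply: eq_from_tnth => i; rewrite tnth_tsub; case: (unliftP ord0 i) => [l|] ->.
  by rewrite !tnthS (inj_eq (@lift_inj _ _)) tnth_tsub.
by [].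
Qed.

Lemma sum_delta (F : pzRingType) n (a : 'I_n) (f : 'I_n -> F) :
  \sum_e (1%:M : 'M[F]_n) a e * f e = f a.
Proof.
rewrite (bigD1 a) //= big1 ?addr0 => [|e ea]; first by rewrite mxE eqxx mul1r.
by rewrite mxE eq_sym (negbTE ea) mul0r.
Qed.

Section LeviCivita.
Variables (R : realType) (U : set 'rV[R]_4) (oU : open U).
Variable g : 'rV[R]_4 -> 'M[R]_4.
Hypothesis gs : forall a b, smooth_on U (fun x => g x a b).
Hypothesis gu : forall x, U x -> g x \in unitmx.
Hypothesis gsym : forall x, U x -> (g x)^T = g x.
Implicit Types (a b c d e m n : 'I_4) (x : 'rV[R]_4).

Local Notation Gam := (christoffel g).

Lemma smooth_lower a b : smooth_on U (lower g a b).
Proof. exact: gs. Qed.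

Lemma smooth_upper a b : smooth_on U (upper g a b).
Proof. exact: smooth_invmx. Qed.

Lemma smooth_christoffel m a b : smooth_on U (Gam m a b).
Proof.
apply: (smoothM oU); first exact: smooth_cst.
apply: smooth_sum => // e; apply: smoothM => //; first exact: smooth_upper.
by repeat first [apply: smoothD => // | apply: smoothN => //
  | apply: smooth_pderiv; exact: smooth_lower].
Qed.

Lemma lowerC a b x : U x -> lower g a b x = lower g b a x.
Proof. by move=> Ux; rewrite /lower -{1}gsym // mxE. Qed.

Lemma christoffelC m a b x : U x -> Gam m a b x = Gam m b a x.
Proof.
move=> Ux; rewrite /christoffel; congr (_ * _); apply: eq_bigr => e _.
congr (_ * _); rewrite [X in X - _]addrC; congr (_ - _).
by apply: (eq_pderiv oU) => // y Uy; exact: lowerC.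
Qed.

Lemma nabla_cons k (T : tensor R k) a (s : k.-tuple 'I_4) x :
  nabla g T [tuple of a :: s] x = pderiv a (T s) x
  - \sum_(j < k) \sum_m Gam m a (tnth s j) x * T (tsub s j m) x.
Proof.
rewrite /nabla; have -> : [tuple of behead [tuple of a :: s]] = s
  by exact: val_inj.
by [].
Qed.

Section RicciIdentity.
Variables (k : nat) (T : tensor R k).
Hypothesis Ts : forall s, smooth_on U (T s).
Implicit Types s : k.-tuple 'I_4.

(** The derivative of the components of [nabla T], by the Leibniz rule. *)
Lemma pderiv_nabla a b s x : U x ->
  pderiv a (nabla g T [tuple of b :: s]) x =
    pderiv a (pderiv b (T s)) x
    - (\sum_(j < k) \sum_m pderiv a (Gam m b (tnth s j)) x * T (tsub s j m) x
      + \sum_(j < k) \sum_m Gam m b (tnth s j) x * pderiv a (T (tsub s j m)) x).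
Proof.
move=> Ux; have sG := smooth_christoffel.
rewrite (eq_pderiv oU a Ux (fun y _ => nabla_cons T b s y)).
have sM j m : smooth_on U (fun y => Gam m b (tnth s j) y * T (tsub s j m) y).
  by apply: smoothM.
have sS j :
  smooth_on U (fun y => \sum_m Gam m b (tnth s j) y * T (tsub s j m) y).
  exact: smooth_sum.
rewrite pderivD; last 2 first.
- by apply: smooth_diff Ux; exact: smooth_pderiv.
- by apply: smooth_diff Ux; apply: smoothN => //; exact: smooth_sum.
congr (_ + _); rewrite pderivN; last by apply: smooth_diff Ux;
  exact: smooth_sum.
congr (- _); rewrite (pderiv_sum oU) // -big_split /=; apply: eq_bigr => j _.
rewrite (pderiv_sum oU) // -big_split /=; apply: eq_bigr => m _.
by rewrite pderivM //; apply: smooth_diff Ux.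
Qed.

(* The terms of [nabla (nabla T)] that are quadratic in the Christoffel symbols.
   [Q1] gathers those where both symbols act on the same index of [T] and [Q0]
   the others; [Q0] is symmetric in [a] and [b]. *)
Let Q a b s x := \sum_(j < k) \sum_m \sum_(i < k) \sum_n
  Gam m a (tnth s j) x
    * (Gam n b (tnth (tsub s j m) i) x * T (tsub (tsub s j m) i n) x).

Let Q0 a b s x := \sum_(j < k) \sum_(i < k | i != j) \sum_m \sum_n
  Gam m a (tnth s j) x * (Gam n b (tnth s i) x * T (tsub (tsub s j m) i n) x).

Let Q1 a b s x := \sum_(j < k) \sum_n (\sum_m
  Gam m a (tnth s j) x * Gam n b m x) * T (tsub s j n) x.

Let Qsplit a b s x : Q a b s x = Q1 a b s x + Q0 a b s x.
Proof.
rewrite -big_split /=; apply: eq_bigr => j _.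
rewrite exchange_big /= (bigD1 j) //=; congr (_ + _).
  rewrite exchange_big /=; apply: eq_bigr => n _.
  rewrite big_distrl /=; apply: eq_bigr => m _.
  by rewrite tnth_tsub eqxx tsub_tsub mulrA.
apply: eq_bigr => i ij; apply: eq_bigr => m _; apply: eq_bigr => n _.
by rewrite tnth_tsub (negbTE ij).
Qed.

Let Q0C a b s x : Q0 a b s x = Q0 b a s x.
Proof.
rewrite /Q0 (exchange_big_dep predT) //=; apply: eq_bigr => i _.
rewrite [LHS](eq_bigl (fun j => j != i)); last by move=> j; rewrite eq_sym.
apply: eq_bigr => j ij; rewrite exchange_big /=; apply: eq_bigr => m _.
apply: eq_bigr => n _; rewrite mulrCA tsubC //.
by rewrite eq_sym.
Qed.

Lemma nabla2E a b s x : U x ->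
  nabla g (nabla g T) [tuple of a :: b :: s] x =
    pderiv a (pderiv b (T s)) x
    - (\sum_(j < k) \sum_m pderiv a (Gam m b (tnth s j)) x * T (tsub s j m) x
      + \sum_(j < k) \sum_m Gam m b (tnth s j) x * pderiv a (T (tsub s j m)) x)
    - (\sum_m Gam m a b x * nabla g T [tuple of m :: s] x
       + (\sum_(j < k) \sum_m Gam m a (tnth s j) x * pderiv b (T (tsub s j m)) x
          - Q a b s x)).
Proof.
move=> Ux.
have -> : [tuple of a :: b :: s] = [tuple of a :: [tuple of b :: s]]
  by exact: val_inj.
rewrite nabla_cons pderiv_nabla //; congr (_ - _ - _).
rewrite big_ord_recl; congr (_ + _).
  by apply: eq_bigr => m _; rewrite tsub_cons0.
rewrite -sumrB; apply: eq_bigr => j _; rewrite -sumrB; apply: eq_bigr => m _.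
rewrite tsub_consS tnthS nabla_cons mulrBr; congr (_ - _).
by rewrite big_distrr /=; apply: eq_bigr => i _; rewrite big_distrr.
Qed.

(** The Ricci identity.  In the antisymmetrization of [nabla2E] the second
    derivatives of [T] cancel, as do the products of a Christoffel symbol and a
    first derivative of [T], the contribution of the derivative index (the
    connection is torsion-free), and [Q0]. *)
Lemma ricci_identity a b s x : U x ->
  alt_nabla2 g T a b s x = - 2^-1 * \sum_(j < k) \sum_n
     riemann_up g n (tnth s j) a b x * T (tsub s j n) x.
Proof.
move=> Ux; rewrite /alt_nabla2 mulNr -mulrN; congr (_ * _).
rewrite !nabla2E // !Qsplit (Q0C b a) (pderivC oU b a) //.
have -> : \sum_m Gam m b a x * nabla g T [tuple of m :: s] x
        = \sum_m Gam m a b x * nabla g T [tuple of m :: s] x.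
  by apply: eq_bigr => m _; rewrite christoffelC.
have -> : \sum_(j < k) \sum_n riemann_up g n (tnth s j) a b x
  * T (tsub s j n) x =
  \sum_(j < k) \sum_m pderiv a (Gam m b (tnth s j)) x * T (tsub s j m) x
  - \sum_(j < k) \sum_m pderiv b (Gam m a (tnth s j)) x * T (tsub s j m) x
  + (Q1 b a s x - Q1 a b s x).
  rewrite -!sumrB -big_split /=; apply: eq_bigr => j _.
  rewrite -!sumrB -big_split /=; apply: eq_bigr => n _.
  rewrite -!mulrBl -mulrDl /riemann_up; congr ((_ + _) * _).
  rewrite -sumrB; apply: eq_bigr => m _.
  by rewrite [Gam n a m x * _]mulrC [Gam n b m x * _]mulrC.
have alg (P A1 A2 B1 B2 N q q' q0 : R) :
  P - (A1 + B1) - (N + (B2 - (q + q0)))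
    - (P - (A2 + B2) - (N + (B1 - (q' + q0)))) = - (A1 - A2 + (q' - q)) by ring.
exact: alg.
Qed.

End RicciIdentity.
Lemma smooth_riemann_up a b c d : smooth_on U (riemann_up g a b c d).
Proof.
have sG := smooth_christoffel.
apply: smoothD => //; first by apply: smoothB => //; exact: smooth_pderiv.
by apply: smooth_sum => // e; apply: smoothB => //; apply: smoothM.
Qed.

Lemma smooth_riemann a b c d : smooth_on U (riemann g a b c d).
Proof.
apply: smooth_sum => // e; apply: smoothM => //.
  exact: smooth_lower.
exact: smooth_riemann_up.
Qed.

Lemma smooth_ricci b d : smooth_on U (ricci g b d).
Proof. by apply: smooth_sum => // a; exact: smooth_riemann_up. Qed.

Lemma smooth_scalar : smooth_on U (scalar_curvature g).
Proof.
apply: smooth_sum => // b; apply: smooth_sum => // d; apply: smoothM => //.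
  exact: smooth_upper.
exact: smooth_ricci.
Qed.

Lemma smooth_weyl a b c d : smooth_on U (weyl g a b c d).
Proof.
have sl := smooth_lower; have sr := smooth_ricci; have ss := smooth_scalar.
have sm := smooth_riemann.
have sq p q m n : smooth_on U (fun x => lower g p q x * ricci g m n x).
  exact: smoothM.
have sp p q m n : smooth_on U (fun x => lower g p q x * lower g m n x).
  exact: smoothM.
apply: smoothD => //.
  apply: smoothB => //; apply: smoothM => //; first exact: smooth_cst.
  by apply: smoothD => //; apply: smoothB => //; exact: smoothB.
apply: smoothM => //; last exact: smoothB.
by apply: smoothM => //; exact: smooth_cst.
Qed.

Lemma riemann_up_anti34 a b c d x : riemann_up g a b c d x
  = - riemann_up g a b d c x.
Proof.
rewrite /riemann_up !opprD opprK -sumrN; congr (_ + _); first by rewrite addrC.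
by apply: eq_bigr => e _; rewrite opprB.
Qed.

(** The first Bianchi identity. *)
Lemma riemann_up_cyclic a b c d x : U x ->
  riemann_up g a b c d x + riemann_up g a c d b x + riemann_up g a d b c x = 0.
Proof.
move=> Ux.
have pC e m n p : pderiv e (Gam m n p) x = pderiv e (Gam m p n) x.
  by apply: (eq_pderiv oU) => // y Uy; exact: christoffelC.
rewrite /riemann_up (pC c a d b) (pC d a c b) (pC b a d c).
pose S m n p := \sum_e Gam a m e x * Gam e n p x.
have SB m n p q : \sum_e (Gam a m e x * Gam e n p x - Gam a n e x * Gam e m q x)
   = S m n p - S n m q. by rewrite /S -sumrB.
rewrite !SB.
have SC m n p : S m n p = S m p n.
  by apply: eq_bigr => e _; rewrite (christoffelC e n p).
rewrite (SC c d b) (SC d c b) (SC b d c).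
have alg (p1 p2 p3 s1 s2 s3 : R) : p1 - p2 + (s1 - s2) + (p2 - p3 + (s2 - s3))
  + (p3 - p1 + (s3 - s1)) = 0 by ring.
exact: alg.
Qed.

Lemma upperK x : U x -> g x *m invmx (g x) = 1%:M.
Proof. by move=> Ux; rewrite mulmxV ?gu. Qed.

Lemma christoffel_lower b a c x : U x ->
  \sum_m lower g b m x * Gam m c a x =
  2^-1
    * (pderiv c (lower g b a) x + pderiv a (lower g b c) x - pderiv b
    (lower g c a) x).
Proof.
move=> Ux; pose X e := pderiv c (lower g e a) x
  + pderiv a (lower g e c) x - pderiv e (lower g c a) x.
transitivity (\sum_m \sum_e lower g b m x * upper g m e x * (2^-1 * X e)).
  apply: eq_bigr => m _; rewrite /christoffel mulrCA !big_distrr /=.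
  by apply: eq_bigr => e _; rewrite [RHS]mulrCA -[in RHS]mulrA.
rewrite exchange_big /= -[RHS](sum_delta b (fun e => 2^-1 * X e)).
apply: eq_bigr => e _; rewrite -mulr_suml -(upperK Ux) mxE.
by [].
Qed.

Let metric_tensor : tensor R 2 := fun s => lower g (tnth s 0) (tnth s 1).

Let nabla_metric a (s : 2.-tuple 'I_4) x : U x ->
  nabla g metric_tensor [tuple of a :: s] x = 0.
Proof.
move=> Ux; rewrite nabla_cons 2!big_ord_recl big_ord0 addr0 /metric_tensor.
under eq_bigr => m _ do rewrite !tnth_tsub /= mulrC lowerC //.
under [X in _ - (_ + X)]eq_bigr => m _ do rewrite !tnth_tsub /= mulrC.
rewrite !christoffel_lower //.
have lC e m n : pderiv e (lower g m n) x = pderiv e (lower g n m) x.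
  by apply: (eq_pderiv oU) => // y Uy; exact: lowerC.
have -> : lift ord0 ord0 = 1 :> 'I_2 by exact: val_inj.
have -> : ord0 = 0 :> 'I_2 by exact: val_inj.
set i := tnth s 0; set j := tnth s 1.
rewrite (lC a j i) (lC i a j) (lC j a i).
have alg (p q r : R) : p - (2^-1 * (p + q - r) + 2^-1 * (p + r - q)) = 0 by lra.
exact: alg.
Qed.

(** The Ricci identity for the metric, whose covariant derivative is zero. *)
Lemma riemann_anti12 a b c d x : U x ->
  riemann g a b c d x = - riemann g b a c d x.
Proof.
move=> Ux; have := ricci_identity (fun s => smooth_lower (tnth s 0) (tnth s 1))
  c d [tuple a; b] Ux.
have -> : alt_nabla2 g (fun s : 2.-tuple 'I_4 => lower g (tnth s 0) (tnth s 1))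
  c d [tuple a; b] x = 0.
  have N e f : nabla g (nabla g metric_tensor) [tuple of e :: f :: [tuple a; b]]
    x = 0.
    have -> : [tuple of e :: f :: [tuple a; b]]
      = [tuple of e :: [tuple of f :: [tuple a; b]]].
      exact: val_inj.
    rewrite nabla_cons (eq_pderiv (g := cst 0) oU) //; last first.
      by move=> y Uy; exact: nabla_metric.
    rewrite /pderiv derive_cst sub0r big1 ?oppr0 // => j _;
      rewrite big1 // => m _.
    case: (unliftP ord0 j) => [l|] ->.
      by rewrite tsub_consS nabla_metric // mulr0.
    by rewrite tsub_cons0 nabla_metric // mulr0.
  by rewrite /alt_nabla2 !N subrr mulr0.
rewrite 2!big_ord_recl big_ord0 addr0.
move=> /esym/eqP; rewrite mulf_eq0 oppr_eq0 invr_eq0 pnatr_eq0 /= addr_eq0 =>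
  /eqP e.
have E p q : riemann g p q c d x = \sum_n riemann_up g n q c d x
  * lower g n p x.
  by apply: eq_bigr => n _; rewrite mulrC (lowerC n p).
suff {E} e' : \sum_n riemann_up g n a c d x * lower g n b x
             = - \sum_n riemann_up g n b c d x * lower g n a x.
  by rewrite !E e' opprK.
transitivity (\sum_n riemann_up g n (tnth [tuple a; b] ord0) c d x *
       lower g (tnth (tsub [tuple a; b] ord0 n) 0)
         (tnth (tsub [tuple a; b] ord0 n) 1) x).
  by apply: eq_bigr => n _; rewrite !tnth_tsub.
rewrite e; congr (- _); apply: eq_bigr => n _.
by rewrite !tnth_tsub [lower g n a x]lowerC.
Qed.

Lemma riemann_anti34 a b c d x : riemann g a b c d x = - riemann g a b d c x.
Proof.
by rewrite /riemann -sumrN; apply: eq_bigr => e _;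
  rewrite riemann_up_anti34 mulrN.
Qed.

Lemma riemann_cyclic a b c d x : U x ->
  riemann g a b c d x + riemann g a c d b x + riemann g a d b c x = 0.
Proof.
move=> Ux; rewrite /riemann -!big_split /= big1 // => e _.
by rewrite -!mulrDr riemann_up_cyclic // mulr0.
Qed.

Lemma riemann_pair a b c d x : U x -> riemann g a b c d x = riemann g c d a b x.
Proof.
move=> Ux.
have A p q r s := riemann_anti12 p q r s Ux.
have B p q r s := riemann_anti34 p q r s x.
have C p q r s := riemann_cyclic p q r s Ux.
have := C a b c d; have := C b c d a; have := C c d a b; have := C d a b c.
rewrite (A b a) (B a c d b) (A c b) (A c a) (A d c) (A d a) (A d b).
rewrite (B a b) (B a d) (B b d) (B b c) (B c d).
have alg (p q s t u v : R) : - - s - - t - - q = 0 -> - q - u - - v = 0 ->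
  - v + t - - p = 0 -> - p - u - s = 0 -> - p = - q by move=> *; lra.
exact: alg.
Qed.

Lemma riemann_upE a b c d x : U x ->
  riemann_up g a b c d x = \sum_e upper g a e x * riemann g e b c d x.
Proof.
move=> Ux; rewrite /riemann.
under eq_bigr => e _ do rewrite big_distrr /=.
rewrite exchange_big /= -[LHS](sum_delta a (fun e => riemann_up g e b c d x)).
apply: eq_bigr => e _; rewrite -(mulVmx (gu Ux)) mxE mulr_suml.
by apply: eq_bigr => m _; rewrite mulrA.
Qed.

(** The vanishing of [nabla_[a nabla_b] T] at a point, for fixed [a] and [b]:
    the curvature endomorphism [R^m_cab] acts trivially on [T]. *)
Lemma alt_nabla2_tensor4 (T : 'I_4 -> 'I_4 -> 'I_4 -> 'I_4 -> 'rV[R]_4 ->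
  R) a b x :
  U x -> (forall c d e f, smooth_on U (T c d e f)) ->
  (forall s, alt_nabla2 g (tensor4 T) a b s x = 0) <->
  (forall c d e f,
    \sum_m riemann_up g m c a b x * T m d e f x +
    \sum_m riemann_up g m d a b x * T c m e f x +
    \sum_m riemann_up g m e a b x * T c d m f x +
    \sum_m riemann_up g m f a b x * T c d e m x = 0).
Proof.
move=> Ux sT.
have E s : alt_nabla2 g (tensor4 T) a b s x = - 2^-1 * (
    \sum_m riemann_up g m (tnth s 0) a b x
      * T m (tnth s 1) (tnth s 2) (tnth s 3) x +
    \sum_m riemann_up g m (tnth s 1) a b x
      * T (tnth s 0) m (tnth s 2) (tnth s 3) x +
    \sum_m riemann_up g m (tnth s 2) a b x
      * T (tnth s 0) (tnth s 1) m (tnth s 3) x +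
    \sum_m riemann_up g m (tnth s 3) a b x * T (tnth s 0) (tnth s 1) (tnth s 2)
      m x).
  rewrite ricci_identity //; last by move=> s'; exact: sT.
  congr (_ * _); rewrite 4!big_ord_recl big_ord0 addr0 !addrA.
  have -> : lift ord0 (lift ord0 (lift ord0 ord0)) = 3 :> 'I_4
    by exact: val_inj.
  have -> : lift ord0 (lift ord0 ord0) = 2 :> 'I_4 by exact: val_inj.
  have -> : lift ord0 ord0 = 1 :> 'I_4 by exact: val_inj.
  have -> : ord0 = 0 :> 'I_4 by exact: val_inj.
  by congr (_ + _ + _ + _); apply: eq_bigr => m _; rewrite /tensor4 !tnth_tsub.
split=> [H c d e f|H s].
  have := H [tuple c; d; e; f]; rewrite E => /eqP.
  by rewrite mulf_eq0 oppr_eq0 invr_eq0 pnatr_eq0 /= => /eqP.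
by rewrite E H mulr0.
Qed.

End LeviCivita.

(** * Spinor components in a null frame *)

(** The vectors of a null tetrad are indexed by the pairs (A, A') of spinor
    indices, with values in {0, 1} encoded as booleans. *)
Section NullFrame.
Variable C : numFieldType.
Local Notation idx := (bool * bool)%type.
Implicit Types (i j k l : idx) (P Q a b : nat -> C).

(** The symplectic form [eps] on boolean spinor indices. *)
Definition eps_bool (p q : bool) : C :=
  if p then (if q then 0 else -1) else (if q then 1 else 0).

(* The indices of l, n, m and of the conjugate of m. *)
Definition ix_l : idx := (false, false).
Definition ix_n : idx := (true, true).
Definition ix_m : idx := (false, true).
Definition ix_b : idx := (true, false).

(** The contraction of two indices with the inverse metric, in a null frame
    with g(l, n) = 1 and g(m, conjugate of m) = -1. *)
Definition null_contract (f : idx -> idx -> C) : C :=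
  f ix_l ix_n + f ix_n ix_l - f ix_m ix_b - f ix_b ix_m.

(** The 2-form a_AB eps_A'B' + b_A'B' eps_AB.  A symmetric spinor is encoded by
    the function giving its component as a function of the number of its indices
    that are equal to 1. *)
Definition so_of_spinors a b i j : C :=
  a (i.1 + j.1)%N * eps_bool i.2 j.2 + b (i.2 + j.2)%N * eps_bool i.1 j.1.

(** The Weyl tensor P_ABCD eps_A'B' eps_C'D' + Q_A'B'C'D' eps_AB eps_CD, with
    the same encoding of symmetric spinors. *)
Definition weyl_of_spinors P Q i j k l : C :=
  P (i.1 + j.1 + k.1 + l.1)%N * eps_bool i.2 j.2 * eps_bool k.2 l.2
  + Q (i.2 + j.2 + k.2 + l.2)%N * eps_bool i.1 j.1 * eps_bool k.1 l.1.

(** Complex conjugation, on the indices of a null frame. *)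
Definition conj_ix i : idx := (i.2, i.1).

(** The symmetric spinors of rank 2 and 4 with given components. *)
Definition quad (c0 c1 c2 : C) (n : nat) : C :=
  match n with 0 => c0 | 1 => c1 | _ => c2 end.
Definition quartic (c0 c1 c2 c3 c4 : C) (n : nat) : C :=
  match n with 0 => c0 | 1 => c1 | 2 => c2 | 3 => c3 | _ => c4 end.

(** The spinor a_AB of a 2-form; its middle component is an average. *)
Definition spinor_of_so (A : idx -> idx -> C) : nat -> C :=
  quad (A ix_l ix_m) (2^-1 * (A ix_l ix_n - A ix_m ix_b)) (A ix_b ix_n).
(** The Newman-Penrose scalars Psi_0, ..., Psi_4 of a Weyl tensor. *)
Definition weyl_scalars (w : idx -> idx -> idx -> idx -> C) : nat -> C :=
  quartic (w ix_l ix_m ix_l ix_m) (w ix_l ix_n ix_l ix_m)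
    (w ix_l ix_m ix_b ix_n)
          (w ix_l ix_n ix_b ix_n) (w ix_n ix_b ix_n ix_b).

Lemma so_of_spinorsE (A : idx -> idx -> C) :
  (forall i j, A i j = - A j i) ->
  forall i j, A i j = so_of_spinors (spinor_of_so A)
    (spinor_of_so (fun i j => A (conj_ix i) (conj_ix j))) i j.
Proof.
move=> anti i j.
have diag k : A k k = 0.
  by apply/eqP; have := addNr (A k k); rewrite -anti => /eqP;
    rewrite -mulr2n mulrn_eq0.
have two : (2 : C) != 0 by rewrite pnatr_eq0.
case: i => [[] []]; case: j => [[] []];
  rewrite /so_of_spinors /spinor_of_so /conj_ix /= ?diag /ix_l /ix_n /ix_m
  /ix_b.
all: rewrite ?(anti (true, true) (false, false))
  ?(anti (true, false) (false, true)).
all: rewrite ?(anti (false, true) (false, false))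
  ?(anti (true, false) (false, false)).
all: rewrite ?(anti (true, true) (false, true))
  ?(anti (true, true) (true, false)).
all: by field.
Qed.

(** The algebraic symmetries of a Weyl tensor, in a null frame. *)
Record weyl_like (w : idx -> idx -> idx -> idx -> C) : Prop := WeylLike {
  wl_anti : forall i j k l, w i j k l = - w j i k l;
  wl_pair : forall i j k l, w i j k l = w k l i j;
  wl_cyc : forall i j k l, w i j k l + w i k l j + w i l j k = 0;
  wl_trace : forall j l, null_contract (fun i k => w i j k l) = 0 }.

(** A Weyl tensor is zero if its Newman-Penrose scalars and those of its
    conjugate are.  The digits in the names of the facts below stand for the
    indices of a component: 0, 1, 2, 3 for l, n, m and the conjugate of m. *)
Lemma weyl_like0 w : weyl_like w ->
  (forall n, weyl_scalars w n = 0) ->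
  (forall n, weyl_scalars (fun i j k l => w (conj_ix i) (conj_ix j) (conj_ix k)
    (conj_ix l)) n = 0) ->
  forall i j k l, w i j k l = 0.
Proof.
move=> [A P Cy T] p q.
have B i j k l : w i j k l = - w i j l k by rewrite P A P.
have dbl (x : C) : x + x = 0 -> x = 0.
  by move/eqP; rewrite -mulr2n mulrn_eq0 => /eqP.
have d12 i k l : w i i k l = 0 by apply: dbl; rewrite {1}A addNr.
have d34 i j k : w i j k k = 0 by apply: dbl; rewrite {1}B addNr.
have s12 i j k l : w i j k l = 0 -> w j i k l = 0 by move=> e;
  rewrite A e oppr0.
have s34 i j k l : w i j k l = 0 -> w i j l k = 0 by rewrite P => /s12;
  rewrite P.
have sp i j k l : w i j k l = 0 -> w k l i j = 0 by rewrite P.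
have t j l : w ix_l j ix_n l + w ix_n j ix_l l - w ix_m j ix_b l - w ix_b j ix_m
  l = 0 := T j l.
have z0202 := p 0; have z0102 := p 1; have z0231 := p 2; have z0131 := p 3.
have z1313 := p 4; rewrite /weyl_scalars /= in z0202 z0102 z0231 z0131 z1313.
have z0303 : w ix_l ix_b ix_l ix_b = 0 := q 0; have z0103 :
  w ix_l ix_n ix_l ix_b = 0 := q 1.
have z0321 : w ix_l ix_b ix_m ix_n = 0 := q 2; have z0121 :
  w ix_l ix_n ix_m ix_n = 0 := q 3.
have z1212 : w ix_n ix_m ix_n ix_m = 0 := q 4.
have swap (i j k l : idx) : w j i l k = w i j k l by rewrite A B opprK.
have z0213 : w ix_l ix_m ix_n ix_b = 0 by exact: s34.
have z0312 : w ix_l ix_b ix_n ix_m = 0 by exact: s34.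
have z0203 : w ix_l ix_m ix_l ix_b = 0.
  have := t ix_l ix_l;
    rewrite d12 d34 (swap ix_l ix_m ix_l ix_b) (swap ix_l ix_b ix_l ix_m)
    (P ix_l ix_b) add0r sub0r -opprD.
  by move/eqP; rewrite oppr_eq0 => /eqP/dbl.
have z1213 : w ix_n ix_m ix_n ix_b = 0.
  have := t ix_n ix_n;
    rewrite d12 d34 (swap ix_n ix_m ix_n ix_b) (swap ix_n ix_b ix_n ix_m)
    (P ix_n ix_b) add0r sub0r -opprD.
  by move/eqP; rewrite oppr_eq0 => /eqP/dbl.
have z0212 : w ix_l ix_m ix_n ix_m = 0.
  by have := t ix_m ix_m; rewrite d12 d34 !subr0 (P ix_n ix_m) => /dbl.
have z0313 : w ix_l ix_b ix_n ix_b = 0.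
  by have := t ix_b ix_b; rewrite d12 d34 !subr0 (P ix_n ix_b) => /dbl.
have z0223 : w ix_l ix_m ix_m ix_b = 0.
  have e := t ix_l ix_m;
    rewrite !(d12, d34) (s12 _ _ _ _ z0102) (swap ix_l ix_m ix_m ix_b) in e.
  by rewrite -[RHS]oppr0 -[X in - X]e; ring.
have z0323 : w ix_l ix_b ix_m ix_b = 0.
  have e := t ix_l ix_b;
    rewrite !(d12, d34) (s12 _ _ _ _ z0103) (A ix_b ix_l ix_m ix_b) in e.
  by rewrite -[RHS]e; ring.
have z1223 : w ix_n ix_m ix_m ix_b = 0.
  have e := t ix_n ix_m;
    rewrite !(d12, d34) (s34 _ _ _ _ z0121) (swap ix_n ix_m ix_m ix_b) in e.
  by rewrite -[RHS]oppr0 -[X in - X]e; ring.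
have z1323 : w ix_n ix_b ix_m ix_b = 0.
  have e := t ix_n ix_b;
    rewrite !(d12, d34) (s34 _ _ _ _ z0131) (A ix_b ix_n ix_m ix_b) in e.
  by rewrite -[RHS]e; ring.
have z0101 : w ix_l ix_n ix_l ix_n = 0.
  have e := t ix_l ix_n;
    rewrite !(d12, d34) (s12 _ _ _ _ z0231) (s12 _ _ _ _ z0321)
    (A ix_n ix_l ix_l ix_n) in e.
  by rewrite -[RHS]oppr0 -[X in - X]e; ring.
have z2323 : w ix_m ix_b ix_m ix_b = 0.
  have e := t ix_m ix_b;
    rewrite !(d12, d34) z0213 (sp _ _ _ _ z0312) (A ix_b ix_m ix_m ix_b) in e.
  by rewrite -[RHS]e; ring.
have z0123 : w ix_l ix_n ix_m ix_b = 0.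
  by have := Cy ix_l ix_n ix_m ix_b; rewrite z0231 z0312 !addr0.
have z0112 : w ix_l ix_n ix_n ix_m = 0 by exact: s34.
have z0113 : w ix_l ix_n ix_n ix_b = 0 by exact: s34.
move=> i j k l.
case: i => [[] []]; case: j => [[] []]; try exact: d12.
all: case: k => [[] []]; case: l => [[] []]; try exact: d34.
all: first [assumption | apply: s12; assumption | apply: s34; assumption
  | apply: s12; apply: s34; assumption | apply: sp; assumption
  | apply: sp; apply: s12; assumption | apply: sp; apply: s34; assumption
  | apply: sp; apply: s12; apply: s34; assumption].
Qed.

(** The components of a tensor in the conjugate null frame. *)
Definition conjW (w : idx -> idx -> idx -> idx -> C) i j k l :=
  w (conj_ix i) (conj_ix j) (conj_ix k) (conj_ix l).

Lemma weyl_like_of_spinors P Q : weyl_like (weyl_of_spinors P Q).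
Proof.
split.
- by case=> [[] []] [[] []] k l; rewrite /weyl_of_spinors /=; ring.
- move=> [i i'] [j j'] [k k'] [l l']; rewrite /weyl_of_spinors /=.
  have e (a b c d : nat) : (a + b + c + d = c + d + a + b)%N
    by rewrite -addnA addnC addnA.
  by rewrite (e i) (e i'); ring.
- by case=> [[] []] [[] []] [[] []] [[] []]; rewrite /weyl_of_spinors /=; ring.
- by case=> [[] []] [[] []]; rewrite /null_contract /weyl_of_spinors /=; ring.
Qed.

Lemma weyl_likeB w w' : weyl_like w -> weyl_like w' ->
  weyl_like (fun i j k l => w i j k l - w' i j k l).
Proof.
move=> [A P Cy T] [A' P' Cy' T']; split=> [i j k l|i j k l|i j k l|j l].
- by rewrite A A' opprB addrC opprK.
- by rewrite P P'.
- have := Cy i j k l; have := Cy' i j k l.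
  by move=> e' e; rewrite -[RHS](subr0 0) -{1}e -e'; ring.
- have := T j l; have := T' j l; rewrite /null_contract.
  by move=> e' e; rewrite -[RHS](subr0 0) -{1}e -e'; ring.
Qed.

(** The spinor decomposition of the Weyl tensor. *)
Lemma weyl_likeE w : weyl_like w ->
  forall i j k l, w i j k l = weyl_of_spinors (weyl_scalars w)
    (weyl_scalars (conjW w)) i j k l.
Proof.
move=> W i j k l; apply/eqP; rewrite -subr_eq0; apply/eqP.
apply: (weyl_like0 (weyl_likeB W (weyl_like_of_spinors _ _))).
- by move=> [|[|[|[|n]]]]; rewrite /weyl_scalars /weyl_of_spinors /=; ring.
- by move=> [|[|[|[|n]]]]; rewrite /weyl_scalars /conjW /weyl_of_spinors /=;
  ring.
Qed.

(** The contraction A_i^p f_p. *)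
Definition raise (A : idx -> idx -> C) i (f : idx -> C) : C :=
  null_contract (fun p q => A i p * f q).

(** The infinitesimal action of the 2-form [A] on a tensor of rank 4. *)
Definition so_act (A : idx -> idx -> C) (w : idx -> idx -> idx -> idx ->
  C) i j k l : C :=
  raise A i (fun p => w p j k l) + raise A j (fun p => w i p k l)
  + raise A k (fun p => w i j p l) + raise A l (fun p => w i j k p).

(** The vanishing of a_(A^E P_BCD)E, that is of the Poisson bracket of the
    binary forms a and P, written in components. *)
Definition kills_quartic a P : Prop :=
  [/\ a 1%N * P 0%N = a 0%N * P 1%N,
      a 2%N * P 0%N + 2 * a 1%N * P 1%N = 3 * a 0%N * P 2%N,
      a 2%N * P 1%N = a 0%N * P 3%N,
      3 * a 2%N * P 2%N = 2 * a 1%N * P 3%N + a 0%N * P 4%N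
    & a 2%N * P 3%N = a 1%N * P 4%N].

(** The action of a 2-form on a Weyl tensor respects the spinor decomposition,
    so each of the five equations is a single component of the hypothesis. *)
Lemma so_act_kills_quartic a b P Q :
  (forall i j k l, so_act (so_of_spinors a b) (weyl_of_spinors P Q) i j k l = 0)
  ->
  kills_quartic a P.
Proof.
move=> H.
have n0 (m : nat) (x : C) : x *+ m.+1 = 0 -> x = 0 by move/eqP;
  rewrite mulrn_eq0 => /eqP.
split; apply/eqP; rewrite -subr_eq0; apply/eqP.
- by apply: (n0 3%N);
  rewrite -[RHS](H ix_l ix_m ix_l ix_m) /so_act /raise /null_contract
  /weyl_of_spinors /so_of_spinors /=; ring.
- by apply: (n0 0%N);
  rewrite -[RHS](H ix_l ix_n ix_l ix_m) /so_act /raise /null_contract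
  /weyl_of_spinors /so_of_spinors /=; ring.
- by apply: (n0 1%N);
  rewrite -[RHS](H ix_l ix_m ix_b ix_n) /so_act /raise /null_contract
  /weyl_of_spinors /so_of_spinors /=; ring.
- by apply: (n0 0%N);
  rewrite -[RHS](H ix_l ix_n ix_b ix_n) /so_act /raise /null_contract
  /weyl_of_spinors /so_of_spinors /=; ring.
- by apply: (n0 3%N);
  rewrite -[RHS](H ix_n ix_b ix_n ix_b) /so_act /raise /null_contract
  /weyl_of_spinors /so_of_spinors /=; ring.
Qed.

(** If a <> 0 the five equations determine P up to a factor, and the square of
    the quadratic form a satisfies them. *)
Lemma kills_quartic_square a P : kills_quartic a P ->
  (exists2 k, (k < 3)%N & a k != 0) ->
  exists c, [/\ P 0%N = c * a 0%N ^+ 2, P 1%N = c * a 0%N * a 1%N,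
     P 2%N = c * (a 0%N * a 2%N + 2 * a 1%N ^+ 2) / 3,
     P 3%N = c * a 1%N * a 2%N & P 4%N = c * a 2%N ^+ 2].
Proof.
move=> [e0 e1 e2 e3 e4] a_neq0.
have [a0|a0] := eqVneq (a 0%N) 0; last first.
  exists (P 0%N / a 0%N ^+ 2).
  have p1 : P 1%N = a 1%N * P 0%N / a 0%N by rewrite e0 mulrAC divff // mul1r.
  have p2 : P 2%N = (a 2%N * P 0%N + 2 * a 1%N * P 1%N) / (3 * a 0%N).
    by rewrite e1 mulrC mulKf // mulf_neq0 // pnatr_eq0.
  have p3 : P 3%N = a 2%N * P 1%N / a 0%N by rewrite e2 mulrAC divff // mul1r.
  have p4 : P 4%N = (3 * a 2%N * P 2%N - 2 * a 1%N * P 3%N) / a 0%N.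
    by rewrite e3 addrC addKr mulrAC divff // mul1r.
  split; rewrite ?p4 ?p3 ?p2 ?p1; field; rewrite ?a0 ?pnatr_eq0 //.
have [a2|a2] := eqVneq (a 2%N) 0; last first.
  exists (P 4%N / a 2%N ^+ 2).
  have p3 : P 3%N = a 1%N * P 4%N / a 2%N by rewrite -e4 mulrAC divff // mul1r.
  have p2 : P 2%N = (a 0%N * P 4%N + 2 * a 1%N * P 3%N) / (3 * a 2%N).
    by rewrite [X in X / _]addrC -e3 mulrC mulKf // mulf_neq0 // pnatr_eq0.
  have p1 : P 1%N = a 0%N * P 3%N / a 2%N by rewrite -e2 mulrAC divff // mul1r.
  have p0 : P 0%N = (3 * a 0%N * P 2%N - 2 * a 1%N * P 1%N) / a 2%N.
    by rewrite -e1 addrK mulrAC divff // mul1r.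
  split; rewrite ?p0 ?p1 ?p2 ?p3; field; rewrite ?a2 ?pnatr_eq0 //.
have a1 : a 1%N != 0.
  by case: a_neq0 => [[|[|[|//]]] _]; rewrite ?a0 ?a2 ?eqxx.
exists (3 * P 2%N / (2 * a 1%N ^+ 2)).
have z (x : C) : a 1%N * x = 0 -> x = 0 by move/eqP;
  rewrite mulf_eq0 (negbTE a1) => /eqP.
have p0 : P 0%N = 0 by apply: z; rewrite e0 a0 mul0r.
have p4 : P 4%N = 0 by apply: z; rewrite -e4 a2 mul0r.
have n2 : (2 : C) != 0 by rewrite pnatr_eq0.
have p1 : P 1%N = 0.
  apply: z; apply: (mulfI n2); move: e1.
  by rewrite a0 a2 !(mul0r, mulr0) add0r -mulrA.
have p3 : P 3%N = 0.
  apply: z; apply: (mulfI n2); move: e3.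
  by rewrite a0 a2 !(mul0r, mulr0) addr0 -mulrA.
rewrite a0 a2 p0 p1 p3 p4; split; try ring.
by field; rewrite a1.
Qed.

(** With P = c a^2, the bracket of b and P is 2 c a times that of b and a;
    as there are no zero divisors, the latter vanishes. *)
Lemma kills_quartic_proportional a b P : kills_quartic a P ->
  kills_quartic b P -> (exists2 k, (k < 5)%N & P k != 0) ->
  [/\ a 0%N * b 1%N = a 1%N * b 0%N, a 0%N * b 2%N = a 2%N * b 0%N &
      a 1%N * b 2%N = a 2%N * b 1%N].
Proof.
move=> sa [e0 e1 e2 e3 e4] P0.
have [a_neq0|a_eq0] := pselect (exists2 k, (k < 3)%N & a k != 0); last first.
  have az (n : nat) : (n < 3)%N -> a n = 0.
    by move=> n3; have [//|an] := eqVneq (a n) 0; case: a_eq0; exists n.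
  by rewrite !az // !mul0r.
have [c [p0 p1 p2 p3 p4]] := kills_quartic_square sa a_neq0.
have c0 : c != 0.
  apply/eqP => c0; case: P0 => [[|[|[|[|[|//]]]]] _];
  by rewrite ?p0 ?p1 ?p2 ?p3 ?p4 c0 !mul0r eqxx.
rewrite {}p0 {}p1 {}p2 {}p3 {}p4 in e0 e1 e2 e3 e4.
(* [x], [y], [z] are the components of the bracket of a and b. *)
pose x := a 0%N * b 1%N - a 1%N * b 0%N; pose y := a 0%N * b 2%N - a 2%N
  * b 0%N.
pose z := a 1%N * b 2%N - a 2%N * b 1%N.
have i0 :
  c * (a 0%N * x) = 0 by rewrite -[RHS](subrr (b 1%N * (c * a 0%N ^+ 2)))
  [X in _ - X]e0 /x; ring.
have i1 : c * (a 0%N * y + 2 * a 1%N * x) = 0.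
  rewrite -[RHS](subrr (b 2%N * (c * a 0%N ^+ 2) + 2 * b 1%N
    * (c * a 0%N * a 1%N))).
  by rewrite [X in _ - X]e1 /x /y; field.
have i2 : c * (a 1%N * y) = 0.
  by rewrite -[RHS](subrr (b 2%N * (c * a 0%N * a 1%N))) [X in _ - X]e2 /y;
    ring.
have i3 : c * (a 2%N * y + 2 * a 1%N * z) = 0.
  rewrite -[RHS](subrr (2 * b 1%N * (c * a 1%N * a 2%N) + b 0%N
    * (c * a 2%N ^+ 2))).
  by rewrite -[X in X - _]e3 /z /y; field.
have i4 : c * (a 2%N * z) = 0.
  by rewrite -[RHS](subrr (b 2%N * (c * a 1%N * a 2%N))) [X in _ - X]e4 /z;
    ring.
have i5 : a 0%N * z = a 1%N * y - a 2%N * x by rewrite /x /y /z; ring.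
have i6 : a 2%N * x = a 1%N * y - a 0%N * z by rewrite /x /y /z; ring.
have n2 : (2 : C) != 0 by rewrite pnatr_eq0.
have K (u v : C) : u != 0 -> u * v = 0 -> v = 0.
  by move=> u0 /eqP; rewrite mulf_eq0 (negbTE u0) => /eqP.
move: i0 i1 i2 i3 i4 => /(K _ _ c0) i0 /(K _ _ c0) i1 /(K _ _ c0) i2 /(K _ _ c0)
  i3 /(K _ _ c0) i4.
suff [x0 y0 z0] : [/\ x = 0, y = 0 & z = 0].
  by split; apply/eqP; rewrite -subr_eq0; apply/eqP.
have [a0|a0] := eqVneq (a 0%N) 0; last first.
  have x0 := K _ _ a0 i0; have y0 : y = 0.
    by apply: (K _ _ a0); move: i1; rewrite x0 mulr0 addr0.
  by split=> //; apply: (K _ _ a0); rewrite i5 x0 y0 !mulr0 subr0.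
have [a2|a2] := eqVneq (a 2%N) 0; last first.
  have z0 := K _ _ a2 i4; have y0 : y = 0.
    by apply: (K _ _ a2); move: i3; rewrite z0 mulr0 addr0.
  by split=> //; apply: (K _ _ a2); rewrite i6 z0 y0 !mulr0 subr0.
have a1 : a 1%N != 0.
  by case: a_neq0 => [[|[|[|//]]] _]; rewrite ?a0 ?a2 ?eqxx.
split; first 1 last.
- exact: K _ _ a1 i2.
- by apply: (K _ _ (mulf_neq0 n2 a1)); move: i3; rewrite a2 mul0r add0r.
- by apply: (K _ _ (mulf_neq0 n2 a1)); move: i1; rewrite a0 mul0r add0r.
Qed.

(** 2-forms with proportional spinors commute as endomorphisms. *)
Lemma commute_so_of_spinors a b a' b' :
  [/\ a 0%N * b 1%N = a 1%N * b 0%N, a 0%N * b 2%N = a 2%N * b 0%N &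
      a 1%N * b 2%N = a 2%N * b 1%N] ->
  [/\ a' 0%N * b' 1%N = a' 1%N * b' 0%N, a' 0%N * b' 2%N = a' 2%N * b' 0%N &
      a' 1%N * b' 2%N = a' 2%N * b' 1%N] ->
  forall i j, raise (so_of_spinors a a') i (fun p => so_of_spinors b b' p j)
            = raise (so_of_spinors b b') i (fun p => so_of_spinors a a' p j).
Proof.
move=> [h1 h2 h3] [k1 k2 k3].
pose lie (f g : nat -> C) := quad (2 * (f 1%N * g 0%N - f 0%N * g 1%N))
  (f 2%N * g 0%N - f 0%N * g 2%N) (2 * (f 2%N * g 1%N - f 1%N * g 2%N)).
move=> i j; apply/eqP; rewrite -subr_eq0.
have -> : raise (so_of_spinors a a') i (fun p => so_of_spinors b b' p j)
    - raise (so_of_spinors b b') i (fun p => so_of_spinors a a' p j)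
      = so_of_spinors (lie a b) (lie a' b') i j.
  by case: i j => [[] []] [[] []];
    rewrite /raise /null_contract /so_of_spinors /lie /=; ring.
rewrite /so_of_spinors /lie h1 h2 h3 k1 k2 k3 !subrr.
by case: i j => [[] []] [[] []]; rewrite /= ?mulr0 ?mul0r ?addr0.
Qed.
End NullFrame.

(** * Principal spinors *)

Lemma ord2_ind (P : 'I_2 -> Prop) : P 0 -> P 1 -> forall i, P i.
Proof.
move=> P0 P1 [[|[|//]] i2].
  by rewrite (_ : Ordinal i2 = 0) //; exact: val_inj.
by rewrite (_ : Ordinal i2 = 1) //; exact: val_inj.
Qed.

(** A permutation is given by the image of 0 and a permutation of the rest. *)
Lemma lift_perm_bij n :
  bijective (fun p : 'I_n.+1 * 'S_n => lift_perm ord0 p.1 p.2).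
Proof.
apply: inj_card_bij => [[j s] [j' s'] /= e|]; last first.
  by rewrite card_prod card_ord !card_Sn factS.
have ej : j = j' by rewrite -(lift_perm_id ord0 j s) e lift_perm_id.
rewrite -{}ej in e *; congr (_, _); apply/permP => i.
by apply: (@lift_inj _ j); rewrite -!(lift_perm_lift ord0) e.
Qed.

(** The expansion of a permanent along its first row. *)
Lemma permanent_expand (F : comPzRingType) n (M : 'I_n.+1 -> 'I_n.+1 -> F) :
  \sum_(s : 'S_n.+1) \prod_i M i (s i) =
  \sum_j M ord0 j * \sum_(s : 'S_n) \prod_i M (lift ord0 i) (lift j (s i)).
Proof.
rewrite (reindex _ (onW_bij _ (lift_perm_bij n))) /=.
rewrite -(pair_bigA _ (fun j s => \prod_i M i (lift_perm ord0 j s i))) /=.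
apply: eq_bigr => j _; rewrite big_distrr /=; apply: eq_bigr => s _.
rewrite big_ord_recl lift_perm_id; congr (_ * _).
by apply: eq_bigr => i _; rewrite lift_perm_lift.
Qed.

Section PrincipalSpinors.
Variable R : realType.
Local Notation C := R[i].

Lemma permanent0 (M : 'I_0 -> 'I_0 -> C) : \sum_(s : 'S_0) \prod_i M i (s i)
  = 1.
Proof. by under eq_bigr do rewrite big_ord0; rewrite sumr_const card_Sn. Qed.

Lemma permanent4 (m : nat -> nat -> C) :
  \sum_(s : 'S_4) \prod_(i < 4) m i (s i) =
  \sum_(j1 < 4) m 0%N j1 * \sum_(j2 < 3) m 1%N (lift j1 j2) *
  \sum_(j3 < 2) m 2%N (lift j1 (lift j2 j3)) *
  \sum_(j4 < 1) m 3%N (lift j1 (lift j2 (lift j3 j4))).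
Proof.
rewrite (permanent_expand (fun i j : 'I_4 => m i j)); apply: eq_bigr => j1 _.
congr (_ * _).
rewrite (permanent_expand (fun i j : 'I_3 => m (lift ord0 i) (lift j1 j))).
apply: eq_bigr => j2 _; congr (_ * _).
rewrite (permanent_expand (fun i j : 'I_2 =>
  m (lift ord0 (lift ord0 i)) (lift j1 (lift j2 j)))).
apply: eq_bigr => j3 _; congr (_ * _).
rewrite (permanent_expand (fun i j : 'I_1 =>
  m (lift ord0 (lift ord0 (lift ord0 i))) (lift j1 (lift j2 (lift j3 j))))).
apply: eq_bigr => j4 _.
rewrite
  (permanent0 (fun i j :
  'I_0 => m (lift ord0 (lift ord0 (lift ord0 (lift ord0 i))))
  (lift j1 (lift j2 (lift j3 (lift j4 j)))))).
by rewrite mulr1.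
Qed.

(** The quartic form c a^2, where a has components a0, a1, a2. *)
Definition square_quartic (c a0 a1 a2 : C) : nat -> C :=
  quartic (c * a0 ^+ 2) (c * a0 * a1) (c * (a0 * a2 + 2 * a1 ^+ 2) / 3)
          (c * a1 * a2) (c * a2 ^+ 2).

(** The symmetrized product of c al, al, be, be is c times the square of the
    symmetrized product of al and be. *)
Lemma sym_prod_square_quartic (al be : 'rV[C]_2) (c : C) (A B D E : 'I_2) :
  sym_prod (fun i : 'I_4 => nth 0 [:: c *: al; al; be; be] i) A B D E =
  square_quartic c (al 0 0 * be 0 0) ((al 0 0 * be 0 1 + al 0 1 * be 0 0) / 2)
    (al 0 1 * be 0 1) (A + B + D + E)%N.
Proof.
rewrite /sym_prod.
pose m (i j : nat) : C :=
  nth 0 [:: c *: al; al; be; be] i 0 (nth A [:: A; B; D; E] j).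
have -> : \sum_(s : 'S_4) \prod_(i < 4) nth 0 [:: c *: al; al; be; be] i 0
            (tnth [tuple A; B; D; E] (s i)) = \sum_(s : 'S_4) \prod_(i < 4) m i
              (s i).
  by apply: eq_bigr => s _; apply: eq_bigr => i _; rewrite (tnth_nth A).
rewrite permanent4 !big_ord_recl !big_ord0 /m /= !addr0 {m}.
have -> : (4`!%:R : C) = 24 by [].
move: A B D E.
by do 4 apply: ord2_ind; rewrite !mxE /square_quartic /=; field.
Qed.

Lemma factor_quadratic (a0 a1 a2 : C) : exists al be : 'rV[C]_2,
  [/\ al 0 0 * be 0 0 = a0, (al 0 0 * be 0 1 + al 0 1 * be 0 0) / 2 = a1
    & al 0 1 * be 0 1 = a2].
Proof.
pose v (p q : C) : 'rV[C]_2 := \row_j (if j == 0 then p else q).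
have [->|a00] := eqVneq a0 0.
  exists (v 0 1), (v (2 * a1) a2); rewrite !mxE /=; split; try ring.
  by field.
pose s := sqrtC (a1 ^+ 2 - a0 * a2).
have ss : s ^+ 2 = a1 ^+ 2 - a0 * a2 by rewrite sqrtCK.
exists (v a0 (a1 - s)), (v 1 ((a1 + s) / a0)); rewrite !mxE /=; split;
  first by ring.
  by field.
have -> : (a1 - s) * ((a1 + s) / a0) = (a1 ^+ 2 - s ^+ 2) / a0 by field.
by rewrite ss; field.
Qed.

Lemma square_type (Psi : 'I_2 -> 'I_2 -> 'I_2 -> 'I_2 -> C) (c a0 a1 a2 : C) :
  (forall A B D E, Psi A B D E = square_quartic c a0 a1 a2 (A + B + D + E)) ->
  ~ spinor_type_O Psi -> spinor_type_D Psi \/ spinor_type_N Psi.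
Proof.
move=> PsiE nO.
have c0 : c != 0.
  apply/eqP => c0; apply: nO => A B D E; rewrite PsiE c0 /square_quartic.
  by case: (A + B + D + E)%N => [|[|[|[|n]]]] /=; rewrite !mul0r.
have [al [be [e0 e1 e2]]] := factor_quadratic a0 a1 a2.
pose k (i : 'I_4) := nth 0 [:: c *: al; al; be; be] i.
have kE : principal_spinors Psi k.
  by move=> A B D E; rewrite PsiE /k sym_prod_square_quartic e0 e1 e2.
have [[z z0 ez]|np] := pselect (proportional al be).
  right; split=> //; exists k => //.
  have kal i : exists2 y, y != 0 & k i = y *: al.
    case: i => [[|[|[|[|//]]]] i4]; rewrite /k /=.
    - by exists c.
    - by exists 1; rewrite ?oner_eq0 ?scale1r.
    - by exists z.
    - by exists z.
  move=> i j; have [y y0 ->] := kal i; have [y' y'0 ->] := kal j.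
  by exists (y' / y); rewrite ?mulf_neq0 ?invr_eq0 // scalerA divfK.
left; split=> //; exists k => //; split; rewrite /k /=.
- by exists c^-1; rewrite ?invr_eq0 // scalerA mulVf // scale1r.
- by exists 1; rewrite ?oner_eq0 ?scale1r.
- case=> z z0 e; apply: np; exists (z * c); first by rewrite mulf_neq0.
  by rewrite -scalerA.
Qed.
End PrincipalSpinors.

(** * Tensors in a null frame *)

Section Frame.
Variable F : numClosedFieldType.
Local Notation idx := (bool * bool)%type.
Implicit Types (u v : 'rV[F]_4) (i j k l : idx).

(** The contraction of the vector [u] with a covector.  Iterated contractions
    express the components of a tensor in a frame. *)
Definition dot u (f : 'I_4 -> F) : F := \sum_a u 0 a * f a.

Lemma eq_dot u f g : (forall a, f a = g a) -> dot u f = dot u g.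
Proof. by move=> fg; apply: eq_bigr => a _; rewrite fg. Qed.

Lemma dotD u f g : dot u (fun a => f a + g a) = dot u f + dot u g.
Proof. by rewrite /dot -big_split; apply: eq_bigr => a _; rewrite mulrDr. Qed.

Lemma dotN u f : dot u (fun a => - f a) = - dot u f.
Proof. by rewrite /dot -sumrN; apply: eq_bigr => a _; rewrite mulrN. Qed.

Lemma dotZ u c f : dot u (fun a => c * f a) = c * dot u f.
Proof. by rewrite /dot mulr_sumr; apply: eq_bigr => a _; rewrite mulrCA. Qed.

Lemma dot0 u f : (forall a, f a = 0) -> dot u f = 0.
Proof. by move=> f0; rewrite /dot big1 // => a _; rewrite f0 mulr0. Qed.

Lemma dot_sum (I : finType) u (f : I -> 'I_4 -> F) :
  dot u (fun a => \sum_m f m a) = \sum_m dot u (f m).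
Proof. by rewrite /dot exchange_big; apply: eq_bigr => a _;
  rewrite mulr_sumr. Qed.

Lemma dot_sumZ u (c : 'I_4 -> F) (f : 'I_4 -> 'I_4 -> F) :
  dot u (fun a => \sum_m c m * f m a) = \sum_m c m * dot u (f m).
Proof. by rewrite dot_sum; apply: eq_bigr => m _; rewrite dotZ. Qed.

Lemma dotC u v (f : 'I_4 -> 'I_4 -> F) :
  dot u (fun a => dot v (f a)) = dot v (fun b => dot u (f^~ b)).
Proof.
rewrite /dot; under eq_bigr => a _ do rewrite mulr_sumr.
rewrite exchange_big; apply: eq_bigr => b _; rewrite mulr_sumr.
by apply: eq_bigr => a _; rewrite mulrCA.
Qed.

Lemma dot_conj u f :
  (dot u f)^* = dot (map_mx (fun z : F => z^*) u) (fun a => (f a)^*).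
Proof. by rewrite rmorph_sum; apply: eq_bigr => a _; rewrite rmorphM mxE. Qed.

Lemma dot_null_contract u (f : 'I_4 -> idx -> idx -> F) :
  dot u (fun a => null_contract (f a))
    = null_contract (fun p q => dot u (fun a => f a p q)).
Proof. by rewrite /null_contract !dotD !dotN. Qed.

Lemma null_contractC (f : idx -> idx -> F) :
  null_contract f = null_contract (fun p q => f q p).
Proof. by rewrite /null_contract; ring. Qed.

Lemma eq_null_contract (f g : idx -> idx -> F) : (forall p q, f p q = g p q) ->
  null_contract f = null_contract g.
Proof. by move=> fg; rewrite /null_contract !fg. Qed.

Variables (G : 'M[F]_4) (e : idx -> 'rV[F]_4).
Hypothesis null_frame : forall i j,
  dot (e i) (fun a => dot (e j) (G a)) = eps_bool F i.1 j.1
    * eps_bool F i.2 j.2.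

(* [N] is the matrix of the frame and [K] that of the metric in it; the latter
   is its own inverse. *)
Let N : 'M[F]_4 := \matrix_i e (nth ix_l [:: ix_l; ix_n; ix_m; ix_b] i).
Let K : 'M[F]_4 := \matrix_(i, j)
  let p := nth ix_l [:: ix_l; ix_n; ix_m; ix_b] i in let q :=
    nth ix_l [:: ix_l; ix_n; ix_m; ix_b] j in
  eps_bool F p.1 q.1 * eps_bool F p.2 q.2.

Let KK : K *m K = 1%:M.
Proof.
apply/matrixP => i j; rewrite !mxE !big_ord_recl big_ord0 !mxE /=.
by case: i => [[|[|[|[|//]]]] ?]; case: j => [[|[|[|[|//]]]] ?] /=;
  rewrite /eps_bool /=; ring.
Qed.

Let NGN : N *m G *m N^T = K.
Proof.
apply/matrixP => i j; rewrite mxE [RHS]mxE /= -null_frame /dot.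
under [RHS]eq_bigr => a _ do rewrite mulr_sumr.
rewrite exchange_big; apply: eq_bigr => b _.
rewrite !mxE mulr_suml; apply: eq_bigr => a _; rewrite !mxE.
by rewrite mulrAC mulrA.
Qed.

Let GNKN : G *m (N^T *m K *m N) = 1%:M.
Proof.
have : N *m (G *m N^T *m K) = 1%:M by rewrite !mulmxA NGN KK.
by move/mulmx1C; rewrite !mulmxA.
Qed.

Lemma frame_unit : G \in unitmx.
Proof. by have [] := mulmx1_unit GNKN. Qed.

(** The completeness relation of the null frame. *)
Lemma inverse_metric a b :
  invmx G a b = null_contract (fun p q => e p 0 a * e q 0 b).
Proof.
have -> : invmx G = N^T *m K *m N.
  by rewrite -[RHS]mul1mx -(mulVmx frame_unit) -[RHS]mulmxA GNKN mulmx1.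
rewrite !mxE !big_ord_recl big_ord0 !mxE !big_ord_recl !big_ord0 !mxE /=
  /null_contract /eps_bool /=.
by ring.
Qed.

Lemma dot_frame_eq0 f : (forall i, dot (e i) f = 0) -> forall a, f a = 0.
Proof.
move=> ef; pose v : 'cV[F]_4 := \col_a f a.
have Nv : N *m v = 0.
  apply/matrixP => i j;
    rewrite !mxE -[RHS](ef (nth ix_l [:: ix_l; ix_n; ix_m; ix_b] i)).
  by apply: eq_bigr => a _; rewrite !mxE.
have Nu : N \in unitmx by have := GNKN; rewrite !mulmxA => /mulmx1_unit[].
have v0 : v = 0 by rewrite -[v](mulKmx Nu) Nv mulmx0.
by move=> a; have /matrixP/(_ a 0) := v0; rewrite !mxE.
Qed.

(** The components in the frame [e] of tensors of rank 2 and 4. *)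
Definition frame2 (A : 'I_4 -> 'I_4 -> F) i j : F :=
  dot (e i) (fun a => dot (e j) (A a)).
Definition frame4 (T : 'I_4 -> 'I_4 -> 'I_4 -> 'I_4 -> F) i j k l : F :=
  dot (e i)
    (fun a => dot (e j) (fun b => dot (e k) (fun c => dot (e l) (T a b c)))).

Lemma frame2_eq0 A : (forall i j, frame2 A i j = 0) -> forall a b, A a b = 0.
Proof.
move=> H a; apply: dot_frame_eq0 => j; move: a; apply: dot_frame_eq0 => i.
exact: H.
Qed.

Lemma frame4_eq0 T : (forall i j k l, frame4 T i j k l = 0) ->
  forall a b c d, T a b c d = 0.
Proof.
move=> H a b c; apply: dot_frame_eq0 => l; move: c; apply: dot_frame_eq0 => k.
move: b; apply: dot_frame_eq0 => j; move: a; apply: dot_frame_eq0 => i.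
exact: H.
Qed.

Lemma frame2_anti A : (forall a b, A a b = - A b a) -> forall i j, frame2 A i j
  = - frame2 A j i.
Proof.
move=> anti i j; rewrite /frame2 dotC -dotN; apply: eq_dot => b.
by rewrite -dotN; apply: eq_dot => a; rewrite anti.
Qed.

Lemma contract_inverse (f : 'I_4 -> 'I_4 -> F) :
  \sum_a \sum_b invmx G a b * f a b =
  null_contract (fun p q => dot (e p) (fun a => dot (e q) (f a))).
Proof.
rewrite -[RHS]/(null_contract (fun p q => \sum_a e p 0 a * \sum_b e q 0 b
  * f a b)).
under [RHS]eq_null_contract => p q do under eq_bigr => a _ do rewrite mulr_sumr.
rewrite /null_contract -!sumrN -!big_split /=; apply: eq_bigr => a _.
rewrite -!sumrN -!big_split /=; apply: eq_bigr => b _.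
by rewrite inverse_metric /null_contract; ring.
Qed.

(** The endomorphism [A^m_c], in one slot of a tensor, becomes a contraction
    with the frame components of [A]. *)
Lemma dot_raise (A : 'I_4 -> 'I_4 -> F) (X : 'I_4 -> F) i :
  (forall a b, A a b = - A b a) ->
  dot (e i) (fun c => \sum_m (\sum_n invmx G m n * A n c) * X m) =
  - raise (frame2 A) i (fun p => dot (e p) X).
Proof.
move=> anti; under eq_dot => c do under eq_bigr => m _ do rewrite mulrC.
rewrite dot_sumZ.
transitivity (\sum_m \sum_n invmx G m n * (X m * dot (e i) (A n))).
  apply: eq_bigr => m _; rewrite dot_sumZ mulr_sumr.
  by apply: eq_bigr => n _; rewrite mulrCA.
rewrite contract_inverse /raise null_contractC /null_contract.
have E p q : dot (e p) (fun a => dot (e q) (fun b => X a * dot (e i) (A b)))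
  = - (frame2 A i q * dot (e p) X).
  under eq_dot => a do rewrite dotZ mulrC.
  by rewrite dotZ (frame2_anti anti) mulNr opprK.
by rewrite !E; ring.
Qed.

Lemma raiseN (A : idx -> idx -> F) i (f : idx -> F) : raise A i (fun p => - f p)
  = - raise A i f.
Proof. by rewrite /raise /null_contract; ring. Qed.

Lemma dot_raiser u (A : idx -> idx -> F) j (f : 'I_4 -> idx -> F) :
  dot u (fun a => raise A j (f a)) = raise A j (fun p => dot u (f^~ p)).
Proof. by rewrite /raise dot_null_contract; apply: eq_null_contract => p q;
  rewrite dotZ. Qed.

(** The infinitesimal action of the endomorphism [A^m_c] on [T]. *)
Definition inf_act (A : 'I_4 -> 'I_4 -> F) (T : 'I_4 -> 'I_4 -> 'I_4 -> 'I_4 ->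
  F)
    c d e' f : F :=
  \sum_m (\sum_n invmx G m n * A n c) * T m d e' f +
  \sum_m (\sum_n invmx G m n * A n d) * T c m e' f +
  \sum_m (\sum_n invmx G m n * A n e') * T c d m f +
  \sum_m (\sum_n invmx G m n * A n f) * T c d e' m.

Lemma frame4_inf_act A T : (forall a b, A a b = - A b a) ->
  forall i j k l, frame4 (inf_act A T) i j k l = - so_act (frame2 A) (frame4 T)
    i j k l.
Proof.
move=> anti i j k l; rewrite /frame4 /inf_act.
under eq_dot => a do under eq_dot => b do under eq_dot => c do
  rewrite !dotD dot_raise // !dot_sumZ.
under eq_dot => a do under eq_dot => b do
  rewrite !dotD dot_raise // !dot_sumZ dotN dot_raiser.
under eq_dot => a do
  rewrite !dotD dot_raise // !dot_sumZ !dotN !dot_raiser.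
rewrite !dotD dot_raise // !dotN !dot_raiser /so_act.
by rewrite !opprD.
Qed.

(** Antisymmetric [A] and [B] that commute in the frame: the action of [A] on
    [B] is zero. *)
Lemma frame2_comm A B : (forall a b, A a b = - A b a) ->
  (forall a b, B a b = - B b a) ->
  (forall i j, raise (frame2 A) i (fun p => frame2 B p j)
    = raise (frame2 B) i (fun p => frame2 A p j)) ->
  forall c d, \sum_m (\sum_n invmx G m n * A n c) * B m d +
    \sum_m (\sum_n invmx G m n * A n d) * B c m = 0.
Proof.
move=> aA aB comm; apply: frame2_eq0 => i j; rewrite /frame2.
under eq_dot => a do rewrite dotD dot_raise // dot_sumZ.
rewrite dotD dot_raise // dotN dot_raiser.
have -> : raise (frame2 A) j (fun p => dot (e i) (fun a => dot (e p) (B a)))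
        = - raise (frame2 A) j (fun p => frame2 B p i).
  rewrite -raiseN /raise; apply: eq_null_contract => p q; congr (_ * _).
  by rewrite -(frame2_anti aB).
rewrite opprK comm addrC; apply/eqP; rewrite subr_eq0; apply/eqP.
rewrite /raise null_contractC; apply: eq_null_contract => p q.
by rewrite (frame2_anti aB) [frame2 A p i](frame2_anti aA) mulrNN mulrC.
Qed.

Section Weyl.
Variable W : 'I_4 -> 'I_4 -> 'I_4 -> 'I_4 -> F.
Hypothesis W_anti : forall a b c d, W a b c d = - W b a c d.
Hypothesis W_pair : forall a b c d, W a b c d = W c d a b.
Hypothesis W_cyc : forall a b c d, W a b c d + W a c d b + W a d b c = 0.
Hypothesis W_trace : forall b d, \sum_a \sum_c invmx G a c * W a b c d = 0.

Lemma weyl_like_frame4 : weyl_like (frame4 W).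
Proof.
split.
- move=> i j k l; rewrite /frame4 dotC -dotN; apply: eq_dot => b.
  rewrite -dotN; apply: eq_dot => a; rewrite -dotN; apply: eq_dot => c.
  by rewrite -dotN; apply: eq_dot => d; exact: W_anti.
- move=> i j k l; rewrite /frame4.
  transitivity
    (dot (e k)
    (fun c =>
    dot (e i) (fun a => dot (e l) (fun d => dot (e j) (fun b => W a b c d))))).
    rewrite [RHS]dotC; apply: eq_dot => a; rewrite dotC; apply: eq_dot => c.
    by rewrite dotC.
  apply: eq_dot => c; rewrite dotC; apply: eq_dot => d; apply: eq_dot => a;
    apply: eq_dot => b.
  exact: W_pair.
- move=> i j k l; rewrite /frame4.
  have -> :
    dot (e i)
    (fun a => dot (e k) (fun b => dot (e l) (fun c => dot (e j) (W a b c))))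
   = dot (e i)
     (fun a =>
     dot (e j) (fun b => dot (e k) (fun c => dot (e l) (fun d => W a c d b)))).
    apply: eq_dot => a; rewrite [RHS]dotC; apply: eq_dot => c.
    by rewrite [RHS]dotC; apply: eq_dot.
  have -> :
    dot (e i)
    (fun a => dot (e l) (fun b => dot (e j) (fun c => dot (e k) (W a b c))))
   = dot (e i)
     (fun a =>
     dot (e j) (fun b => dot (e k) (fun c => dot (e l) (fun d => W a d b c)))).
    apply: eq_dot => a; rewrite dotC; apply: eq_dot => b.
    by rewrite dotC.
  rewrite -!dotD dot0 // => a; rewrite -!dotD dot0 // => b.
  by rewrite -!dotD dot0 // => c; rewrite -!dotD dot0.
- move=> j l; rewrite /frame4.
  transitivity
    (null_contract (fun p q => dot (e p) (fun a => dot (e q) (fun c =>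
     dot (e j) (fun b => dot (e l) (fun d => W a b c d)))))).
    by apply: eq_null_contract => p q; apply: eq_dot => a; rewrite dotC.
  rewrite -contract_inverse.
  transitivity (dot (e j) (fun b => dot (e l) (fun d =>
     \sum_a \sum_c invmx G a c * W a b c d))); last first.
    by apply: dot0 => b; apply: dot0 => d.
  under [RHS]eq_dot => b do rewrite dot_sum.
  rewrite dot_sum; apply: eq_bigr => a _.
  under [RHS]eq_dot => b do rewrite dot_sumZ.
  by rewrite dot_sumZ.
Qed.
End Weyl.

End Frame.

(** * Real curvature tensors at a point *)

(** [G] and [Rm] are the components of the metric and of the Riemann tensor at a
    point.  The Ricci, scalar and Weyl curvatures are computed from them by the
    usual formulas. *)
Section CurvatureAlgebra.
Variable F : numFieldType.
Variables (G : 'M[F]_4) (Rm : 'I_4 -> 'I_4 -> 'I_4 -> 'I_4 -> F).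
Hypothesis Gsym : forall a b, G a b = G b a.
Hypothesis Gu : G \in unitmx.
Hypothesis Rm_anti12 : forall a b c d, Rm a b c d = - Rm b a c d.
Hypothesis Rm_pair : forall a b c d, Rm a b c d = Rm c d a b.
Hypothesis Rm_cyc : forall a b c d, Rm a b c d + Rm a c d b + Rm a d b c = 0.

Local Notation Gi := (invmx G).

Definition ricci_at b d := \sum_a \sum_e Gi a e * Rm e b a d.
Definition scalar_at := \sum_b \sum_d Gi b d * ricci_at b d.
Definition weyl_at a b c d :=
  Rm a b c d
  - 2^-1 * (G a c * ricci_at b d - G a d * ricci_at b c
            - G b c * ricci_at a d + G b d * ricci_at a c)
  + 6^-1 * scalar_at * (G a c * G b d - G a d * G b c).

Lemma Gi_sym a b : Gi a b = Gi b a.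
Proof.
have GT : G^T = G by apply/matrixP => i j; rewrite mxE.
by have /matrixP/(_ a b) := trmx_inv G; rewrite GT mxE.
Qed.

Lemma ricci_at_sym b d : ricci_at b d = ricci_at d b.
Proof.
rewrite /ricci_at exchange_big; apply: eq_bigr => e _; apply: eq_bigr => a _.
by rewrite Rm_pair Gi_sym.
Qed.

Lemma Gi_contract (f : 'I_4 -> F) b : \sum_a \sum_e Gi a e * (G a b * f e)
  = f b.
Proof.
rewrite exchange_big -[RHS](sum_delta b f); apply: eq_bigr => e _.
rewrite -(mulmxV Gu) mxE mulr_suml; apply: eq_bigr => a _.
by rewrite (Gsym a b) mulrCA mulrA.
Qed.

Lemma weyl_at_anti a b c d : weyl_at a b c d = - weyl_at b a c d.
Proof. by rewrite /weyl_at Rm_anti12; ring. Qed.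

Lemma weyl_at_pair a b c d : weyl_at a b c d = weyl_at c d a b.
Proof.
rewrite /weyl_at Rm_pair (Gsym c a) (Gsym c b) (Gsym d a) (Gsym d b).
by rewrite (ricci_at_sym d b) (ricci_at_sym d a) (ricci_at_sym c b)
  (ricci_at_sym c a); ring.
Qed.

Lemma weyl_at_cyc a b c d : weyl_at a b c d + weyl_at a c d b + weyl_at a d b c
  = 0.
Proof.
rewrite /weyl_at -[RHS](Rm_cyc a b c d).
rewrite (Gsym c b) (Gsym d b) (Gsym d c).
by rewrite (ricci_at_sym c b) (ricci_at_sym d b) (ricci_at_sym d c); ring.
Qed.

Lemma sum2D (f g : 'I_4 -> 'I_4 -> F) :
  \sum_a \sum_e (f a e + g a e) = \sum_a \sum_e f a e + \sum_a \sum_e g a e.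
Proof. by rewrite -big_split; apply: eq_bigr => a _; rewrite -big_split. Qed.

Lemma sum2Z c (f : 'I_4 -> 'I_4 -> F) :
  \sum_a \sum_e c * f a e = c * \sum_a \sum_e f a e.
Proof. by rewrite mulr_sumr; apply: eq_bigr => a _; rewrite mulr_sumr. Qed.

Lemma weyl_at_trace b d : \sum_a \sum_c Gi a c * weyl_at a b c d = 0.
Proof.
have T1 : \sum_a \sum_c Gi a c * Rm a b c d = ricci_at b d.
  rewrite /ricci_at exchange_big; apply: eq_bigr => c _; apply: eq_bigr => a _.
  by rewrite Gi_sym.
have T2 x : \sum_a \sum_c Gi a c * (G a c * x) = 4 * x.
  transitivity (\sum_(a < 4) x); last by rewrite sumr_const card_ord mulr_natl.
  have := Gi_contract.
  under eq_bigr => a _ do under eq_bigr => c _ do rewrite (Gsym a c) mulrA.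
  under eq_bigr => a _ do rewrite -mulr_suml.
  move=> _; apply: eq_bigr => a _.
  have /matrixP/(_ a a) := mulVmx Gu; rewrite !mxE eqxx => ->.
  by rewrite mul1r.
have T3 (f : 'I_4 -> F) y : \sum_a \sum_c Gi a c * (G a y * f c) = f y.
  exact: Gi_contract.
have T4 (f : 'I_4 -> F) y : \sum_a \sum_c Gi a c * (G y c * f a) = f y.
  rewrite exchange_big -[RHS]Gi_contract; apply: eq_bigr => c _;
    apply: eq_bigr => a _.
  by rewrite Gi_sym (Gsym y).
have T5 x : \sum_a \sum_c Gi a c * (x * ricci_at a c) = x * scalar_at.
  rewrite -sum2Z; apply: eq_bigr => a _; apply: eq_bigr => c _.
  by rewrite mulrCA.
transitivity (\sum_a \sum_c (Gi a c * Rm a b c d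
   + (- 2^-1 * (Gi a c * (G a c * ricci_at b d))
   + (2^-1 * (Gi a c * (G a d * ricci_at b c))
   + (2^-1 * (Gi a c * (G b c * ricci_at a d))
   + (- 2^-1 * (Gi a c * (G b d * ricci_at a c))
   + (6^-1 * scalar_at * (Gi a c * (G a c * G b d))
   + (- (6^-1 * scalar_at)) * (Gi a c * (G a d * G b c))))))))).
  by apply: eq_bigr => a _; apply: eq_bigr => c _; rewrite /weyl_at; ring.
rewrite !sum2D !sum2Z T1 !T2 (T3 (ricci_at b)) (T4 (ricci_at^~ d)) T5
  (T3 (G b)).
by field.
Qed.

Section Derivation.
Variable U : 'I_4 -> 'I_4 -> F.

(** [kills2 U X] and [kills4 U T]: the derivation of tensors extending the
    endomorphism [U m c] (row index up) maps [X], respectively [T], to zero. *)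
Definition kills2 (X : 'I_4 -> 'I_4 -> F) :=
  forall c d, \sum_m U m c * X m d + \sum_m U m d * X c m = 0.
Definition kills4 (T : 'I_4 -> 'I_4 -> 'I_4 -> 'I_4 -> F) := forall c d e f,
  \sum_m U m c * T m d e f + \sum_m U m d * T c m e f +
  \sum_m U m e * T c d m f + \sum_m U m f * T c d e m = 0.

Lemma kills4_swap12 T : kills4 T -> kills4 (fun a b c d => T b a c d).
Proof. by move=> H c d e f; rewrite [X in X + _ + _]addrC; exact: H. Qed.

Lemma kills4_swap34 T : kills4 T -> kills4 (fun a b c d => T a b d c).
Proof. by move=> H c d e f; rewrite -[RHS](H c d f e) addrAC. Qed.

Lemma kills4D T T' : kills4 T -> kills4 T' ->
  kills4 (fun a b c d => T a b c d + T' a b c d).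
Proof.
move=> H H' c d e f.
have sD (u p q : 'I_4 -> F) : \sum_m u m * (p m + q m) = \sum_m u m * p m
  + \sum_m u m * q m.
  by rewrite -big_split; apply: eq_bigr => m _; rewrite mulrDr.
have alg (p q r s p' q' r' s' : F) : p + q + r + s = 0 ->
    p' + q' + r' + s' = 0 -> p + p' + (q + q') + (r + r') + (s + s') = 0.
  by move=> h h'; rewrite -[RHS]addr0 -{1}h -h'; ring.
by rewrite !sD; exact: alg (H c d e f) (H' c d e f).
Qed.

Lemma kills4Z k T : kills4 T -> kills4 (fun a b c d => k * T a b c d).
Proof.
move=> H c d e f.
have sZ (u p : 'I_4 -> F) : \sum_m u m * (k * p m) = k * \sum_m u m * p m.
  by rewrite mulr_sumr; apply: eq_bigr => m _; rewrite mulrCA.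
by rewrite !sZ -!mulrDr H mulr0.
Qed.

Lemma kills4_prod X Y : kills2 X -> kills2 Y ->
  kills4 (fun a b c d => X a c * Y b d).
Proof.
move=> HX HY c d e f.
have l (u p : 'I_4 -> F) x : \sum_m u m * (p m * x) = (\sum_m u m * p m) * x.
  by rewrite mulr_suml; apply: eq_bigr => m _; rewrite mulrA.
have r (u p : 'I_4 -> F) x : \sum_m u m * (x * p m) = x * (\sum_m u m * p m).
  by rewrite mulr_sumr; apply: eq_bigr => m _; rewrite mulrCA.
rewrite (l (U^~ c)) (r (U^~ d)) (l (U^~ e)) (r (U^~ f)).
have alg (p q p' q' x y : F) : p + p' = 0 -> q + q' = 0 ->
    p * y + x * q + p' * y + x * q' = 0.
  move=> h h'; transitivity ((p + p') * y + x * (q + q')); first by ring.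
  by rewrite h h' mul0r mulr0 addr0.
by apply: alg; [exact: HX|exact: HY].
Qed.
End Derivation.

(** The endomorphism [A^m_c] of the 2-form [A_nc]. *)
Definition endo (A : 'I_4 -> 'I_4 -> F) m c := \sum_n Gi m n * A n c.

Lemma kills2_metric A : (forall a b, A a b = - A b a) -> kills2 (endo A) G.
Proof.
move=> anti c d.
have E x y : \sum_m endo A m x * G m y = A y x.
  transitivity (\sum_m \sum_n Gi m n * (G m y * A n x));
    last exact: Gi_contract.
  apply: eq_bigr => m _; rewrite /endo mulr_suml; apply: eq_bigr => n _.
  by rewrite -mulrA [A n x * _]mulrC.
rewrite E; under eq_bigr => m _ do rewrite Gsym.
by rewrite E anti addNr.
Qed.

(** [A] kills the inverse metric ([GA]), hence commutes with the contraction
    defining the Ricci tensor. *)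
Lemma kills2_ricci A : (forall a b, A a b = - A b a) -> kills4 (endo A) Rm ->
  kills2 (endo A) ricci_at.
Proof.
move=> anti H b d.
have GA a m : \sum_e Gi a e * endo A m e + \sum_e Gi e m * endo A a e = 0.
  have -> : \sum_e Gi e m * endo A a e = \sum_e \sum_n Gi a e
    * (Gi m n * A e n).
    rewrite exchange_big; apply: eq_bigr => e _; rewrite /endo mulr_sumr.
    by apply: eq_bigr => n _; rewrite mulrCA (Gi_sym e m).
  rewrite -big_split big1 //= => e _;
    rewrite -mulr_sumr -mulrDr /endo -big_split.
  by rewrite /= big1 ?mulr0 // => n _; rewrite -mulrDr anti addNr mulr0.
have S1 : \sum_m endo A m b * ricci_at m d
    = \sum_a \sum_e Gi a e * \sum_m endo A m b * Rm e m a d.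
  rewrite /ricci_at; under eq_bigr => m _ do rewrite -sum2Z.
  rewrite exchange_big; apply: eq_bigr => a _; rewrite exchange_big.
  apply: eq_bigr => e _; rewrite mulr_sumr.
  by apply: eq_bigr => m _; rewrite mulrCA.
have S2 : \sum_m endo A m d * ricci_at b m
    = \sum_a \sum_e Gi a e * \sum_m endo A m d * Rm e b a m.
  rewrite /ricci_at; under eq_bigr => m _ do rewrite -sum2Z.
  rewrite exchange_big; apply: eq_bigr => a _; rewrite exchange_big.
  apply: eq_bigr => e _; rewrite mulr_sumr.
  by apply: eq_bigr => m _; rewrite mulrCA.
have S3 : \sum_a \sum_e Gi a e * (\sum_m endo A m e * Rm m b a d)
    + \sum_a \sum_e Gi a e * (\sum_m endo A m a * Rm e b m d) = 0.
  have -> : \sum_a \sum_e Gi a e * (\sum_m endo A m e * Rm m b a d)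
     = \sum_a \sum_m (\sum_e Gi a e * endo A m e) * Rm m b a d.
    apply: eq_bigr => a _; under eq_bigr => e _ do rewrite mulr_sumr.
    rewrite exchange_big; apply: eq_bigr => m _; rewrite mulr_suml.
    by apply: eq_bigr => e _; rewrite mulrA.
  have -> : \sum_a \sum_e Gi a e * (\sum_m endo A m a * Rm e b m d)
     = \sum_a \sum_m (\sum_e Gi e m * endo A a e) * Rm m b a d.
    rewrite exchange_big [RHS]exchange_big; apply: eq_bigr => e _.
    under eq_bigr => a _ do rewrite mulr_sumr.
    rewrite exchange_big; apply: eq_bigr => a _; rewrite mulr_suml.
    by apply: eq_bigr => m _; rewrite mulrA.
  rewrite -sum2D big1 // => a _; rewrite big1 // => m _.
  by rewrite -mulrDl GA mul0r.
rewrite S1 S2 -[LHS]addr0 -[X in _ + X = _]S3 -!sum2D big1 // => a _;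
  rewrite big1 // => e _.
rewrite -!mulrDr -[RHS](mulr0 (Gi a e)) -[X in _ = _ * X](H e b a d).
by congr (_ * _); ring.
Qed.

Lemma kills4_weyl A : (forall a b, A a b = - A b a) -> kills4 (endo A) Rm ->
  kills4 (endo A) weyl_at.
Proof.
move=> anti H.
have HG := kills2_metric anti; have HR := kills2_ricci anti H.
have P1 := kills4_prod HG HR; have P2 := kills4_prod HG HG.
have := kills4D (kills4D H (kills4Z (- 2^-1) (kills4D (kills4D (kills4D P1
  (kills4Z (-1) (kills4_swap34 P1))) (kills4Z (-1) (kills4_swap12 P1)))
  (kills4_swap12 (kills4_swap34 P1)))))
  (kills4Z (6^-1 * scalar_at) (kills4D P2 (kills4Z (-1) (kills4_swap34 P2)))).
move=> H' c d e f; rewrite -[RHS](H' c d e f); congr (_ + _ + _ + _);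
  by apply: eq_bigr => m _; rewrite /weyl_at; congr (_ * _); ring.
Qed.
End CurvatureAlgebra.

(** * From real tensors to spinors *)

Section Pointwise.
Variable R : realType.
Local Notation C := R[i].
Local Notation idx := (bool * bool)%type.
Local Notation "x %:RC" := (real_complex R x) (at level 2, format "x %:RC").

Lemma conj_real (x : R) : (x%:RC)^* = x%:RC.
Proof. exact: conjc_real. Qed.

(** The null tetrad l = s (r0 + r3), n = s (r0 - r3), m = s (r1 + i r2) of an
    orthonormal frame r0, r1, r2, r3, where s is the square root of 1/2. *)
Lemma null_frame_exists (G : 'M[R]_4) : lorentzian G ->
  exists e : idx -> 'rV[C]_4,
    (forall i j, dot (e i) (fun a => dot (e j) (fun b => (G a b)%:RC))
       = eps_bool C i.1 j.1 * eps_bool C i.2 j.2)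
    /\ forall i a, (e i 0 a)^* = e (conj_ix i) 0 a.
Proof.
case=> P _ PG.
pose s : C := (Num.sqrt 2^-1)%:RC.
have ss : s * s = 2^-1.
  by rewrite -rmorphM -expr2 sqr_sqrtr ?invr_ge0 ?ler0n // fmorphV rmorph_nat.
have ii : 'i * 'i = -1 :> C by rewrite -expr2 sqrCi.
pose coef (i : idx) (k : nat) : C :=
  match i with
  | (false, false) => nth 0 [:: s; 0; 0; s] k
  | (true, true) => nth 0 [:: s; 0; 0; - s] k
  | (false, true) => nth 0 [:: 0; s; s * 'i; 0] k
  | (true, false) => nth 0 [:: 0; s; - (s * 'i); 0] k
  end.
pose e i : 'rV[C]_4 := \row_a \sum_(k < 4) coef i k * (P k a)%:RC.
have dot_e i f : dot (e i) f = \sum_(k < 4) coef i k * \sum_a (P k a)%:RC * f a.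
  rewrite /dot; under eq_bigr => a _ do rewrite mxE mulr_suml.
  rewrite exchange_big; apply: eq_bigr => k _; rewrite mulr_sumr.
  by apply: eq_bigr => a _; rewrite mulrA.
have Bkl k l : \sum_a (P k a)%:RC * (\sum_b (P l b)%:RC * (G a b)%:RC)
    = (if k == l then if k == 0 then 1 else -1 else 0).
  transitivity ((P *m G *m P^T) k l)%:RC.
    rewrite mxE rmorph_sum; under eq_bigr => a _ do rewrite mulr_sumr.
    rewrite exchange_big; apply: eq_bigr => b _.
    rewrite !mxE rmorphM rmorph_sum mulr_suml; apply: eq_bigr => a _.
    by rewrite rmorphM -[RHS]mulrA [in RHS](mulrC (G a b)%:RC).
  rewrite PG /Defs.minkowski !mxE; case: (k == l);
    last by rewrite mulr0n rmorph0.
  by rewrite mulr1n; case: ifP => _; rewrite ?rmorphN rmorph1.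
have Be i j : dot (e i) (fun a => dot (e j) (fun b => (G a b)%:RC)) =
  coef i 0%N * coef j 0%N - coef i 1%N * coef j 1%N - coef i 2%N * coef j 2%N
  - coef i 3%N * coef j 3%N.
  rewrite dot_e.
  transitivity (\sum_(k < 4) coef i k * \sum_(l < 4) coef j l *
    (if k == l then if k == 0 then 1 else -1 else 0)).
    apply: eq_bigr => n _; congr (_ * _).
    under eq_bigr => a _ do rewrite dot_e mulr_sumr.
    rewrite exchange_big; apply: eq_bigr => n' _; rewrite -Bkl mulr_sumr.
    by apply: eq_bigr => a _; rewrite mulrCA.
  by rewrite !big_ord_recl !big_ord0 /=; ring.
exists e; split=> [i j|i a].
{ rewrite Be; case: i => [[] []]; case: j => [[] []];
  rewrite /coef /eps_bool /=.
  all: try by ring.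
  all: try by ring: ii.

  all: have h2 : s * s + s * s = 1 by rewrite ss; field.
  all: first
    [ by transitivity (s * s + s * s); [ring | rewrite h2; ring]
    | by transitivity (- (s * s + s * s)); [ring: ii | rewrite h2; ring] ].
}
rewrite !mxE rmorph_sum; apply: eq_bigr => k _; rewrite rmorphM /= conj_real;
  congr (_ * _).
have sr : s^* = s by exact: conj_real.
case: i k => [[] []] [[|[|[|[|//]]]] k4] /=;
  rewrite ?rmorphN ?rmorphM ?rmorph0 /= ?sr ?conjCi ?mulrN ?opprK //.
Qed.
End Pointwise.

Section PointwiseTheorem.
Variable R : realType.
Local Notation C := R[i].
Local Notation idx := (bool * bool)%type.
Local Notation rc := (real_complex R).

Lemma conjW_frame4 (e : idx -> 'rV[C]_4) (W : 'I_4 -> 'I_4 -> 'I_4 -> 'I_4 ->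
  R) :
  (forall i a, (e i 0 a)^* = e (conj_ix i) 0 a) ->
  forall i j k l, conjW (frame4 e (fun a b c d => rc (W a b c d))) i j k l
    = (frame4 e (fun a b c d => rc (W a b c d)) i j k l)^*.
Proof.
move=> ce i j k l.
have dc i' f : (dot (e i') f)^* = dot (e (conj_ix i')) (fun a => (f a)^*).
  by rewrite dot_conj; apply: eq_bigr => a _; rewrite mxE ce.
rewrite /conjW /frame4 dc; apply: eq_dot => a; rewrite dc; apply: eq_dot => b.
rewrite dc; apply: eq_dot => c; rewrite dc; apply: eq_dot => d.
by rewrite conj_real.
Qed.

Lemma conj_frame2 (e : idx -> 'rV[C]_4) (A : 'I_4 -> 'I_4 -> R) :
  (forall i a, (e i 0 a)^* = e (conj_ix i) 0 a) ->
  forall i j, frame2 e (fun a b => rc (A a b)) (conj_ix i) (conj_ix j)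
    = (frame2 e (fun a b => rc (A a b)) i j)^*.
Proof.
move=> ce i j.
have dc i' f : (dot (e i') f)^* = dot (e (conj_ix i')) (fun a => (f a)^*).
  by rewrite dot_conj; apply: eq_bigr => a _; rewrite mxE ce.
rewrite /frame2 dc; apply: eq_dot => a; rewrite dc; apply: eq_dot => b.
by rewrite conj_real.
Qed.

Lemma eps_ebool (A B : 'I_2) : eps R A B = eps_bool C (A == 1) (B == 1).
Proof. by move: A B; do 2 apply: ord2_ind. Qed.

Lemma weyl_of_spinors_contract (P Q : nat -> C) (a b c d : bool) :
  4^-1 * \sum_(A' < 2) \sum_(B' < 2) \sum_(C' < 2) \sum_(D' < 2)
    eps_bool C (A' == 1) (B' == 1) * eps_bool C (C' == 1) (D' == 1) *
    weyl_of_spinors P Q (a, A' == 1) (b, B' == 1) (c, C' == 1) (d, D' == 1)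
  = P (a + b + c + d)%N.
Proof.
have sum2 (f : 'I_2 -> C) : \sum_i f i = f 0 + f 1.
  by rewrite !big_ord_recl big_ord0 addr0; congr (f _ + f _); exact: val_inj.
rewrite !sum2 /=.
by move: a b c d => [] [] [] []; rewrite /weyl_of_spinors /eps_bool /=; field.
Qed.

(** The Infeld-van der Waerden symbols of a null frame. *)
Definition spin_frame (e : idx -> 'rV[C]_4) (A A' : 'I_2) :=
  e (A == 1, A' == 1).

Lemma weyl_spinorE (e : idx -> 'rV[C]_4) (W : 'I_4 -> 'I_4 -> 'I_4 -> 'I_4 ->
  R) :
  let w := frame4 e (fun a b c d => rc (W a b c d)) in weyl_like w ->
  forall A B D E, weyl_spinor W (spin_frame e) A B D E
    = weyl_scalars w (A + B + D + E)%N.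
Proof.
move=> w wl A B D E.
have wE A' B' D' E' :
    \sum_a \sum_b \sum_c \sum_d (rc (W a b c d)) * spin_frame e A A' 0 a *
      spin_frame e B B' 0 b * spin_frame e D D' 0 c * spin_frame e E E' 0 d
    = w (A == 1, A' == 1) (B == 1, B' == 1) (D == 1, D' == 1) (E == 1, E' == 1).
  rewrite /w /frame4 /dot; apply: eq_bigr => a _; rewrite mulr_sumr.
  apply: eq_bigr => b _; rewrite mulr_sumr mulr_sumr; apply: eq_bigr => c _.
  rewrite !mulr_sumr; apply: eq_bigr => d _; rewrite /spin_frame; ring.
rewrite /weyl_spinor.
under eq_bigr => A' _ do under eq_bigr => B' _ do under eq_bigr => D' _ do
  under eq_bigr => E' _ do rewrite wE (weyl_likeE wl) !eps_ebool.
rewrite weyl_of_spinors_contract; congr (weyl_scalars w _).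
by move: A B D E {wE}; do 4 apply: ord2_ind.
Qed.

Section Curv.
Variables (G : 'M[R]_4) (Rm : 'I_4 -> 'I_4 -> 'I_4 -> 'I_4 -> R).
Hypothesis Gsym : forall a b, G a b = G b a.
Hypothesis Glor : lorentzian G.
Hypothesis Rm_anti12 : forall a b c d, Rm a b c d = - Rm b a c d.
Hypothesis Rm_pair : forall a b c d, Rm a b c d = Rm c d a b.
Hypothesis Rm_cyc : forall a b c d, Rm a b c d + Rm a c d b + Rm a d b c = 0.

Lemma lorentzian_unit : G \in unitmx.
Proof.
case: Glor => P Pu PG.
have : \det (P *m G *m P^T) != 0.
  by rewrite PG /Defs.minkowski det_diag prodf_seq_neq0 /=;
    apply/allP => i _ /=; rewrite mxE; case: ifP; rewrite ?oppr_eq0 oner_eq0.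
rewrite !det_mulmx !mulf_eq0 !negb_or => /andP[/andP[_ G0] _].
by rewrite unitmxE unitfE.
Qed.

Let Gu := lorentzian_unit.

(** The curvature 2-form of the directions [a], [b]: R_cdab as a form in the
    indices c, d. *)
Definition curv a b : 'I_4 -> 'I_4 -> R := fun c d => Rm c d a b.

Let W := weyl_at G Rm.
Let Gc : 'M[C]_4 := map_mx rc G.
Let cplx2 (A : 'I_4 -> 'I_4 -> R) : 'I_4 -> 'I_4 -> C := fun a b => rc (A a b).
Let cplx4 (T : 'I_4 -> 'I_4 -> 'I_4 -> 'I_4 -> R) : 'I_4 -> 'I_4 -> 'I_4 ->
  'I_4 -> C :=
  fun a b c d => rc (T a b c d).

Let endoC A m c : \sum_n invmx Gc m n * cplx2 A n c = rc (endo G A m c).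
Proof.
rewrite rmorph_sum; apply: eq_bigr => n _.
by rewrite rmorphM -map_invmx mxE.
Qed.

Let inf_actC A T : kills4 (endo G A) T ->
  forall a b c d, inf_act Gc (cplx2 A) (cplx4 T) a b c d = 0.
Proof.
move=> H a b c d;
  rewrite -[RHS](rmorph0 rc) -[in RHS](H a b c d) !rmorphD !rmorph_sum.
by congr (_ + _ + _ + _); apply: eq_bigr => m _; rewrite endoC rmorphM.
Qed.

Variable e : idx -> 'rV[C]_4.
Hypothesis e_null :
  forall i j, dot (e i) (fun a => dot (e j) (fun b => rc (G a b)))
   = eps_bool C i.1 j.1 * eps_bool C i.2 j.2.
Hypothesis e_conj : forall i a, (e i 0 a)^* = e (conj_ix i) 0 a.

Let null i j : dot (e i) (fun a => dot (e j) (Gc a)) = eps_bool C i.1 j.1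
  * eps_bool C i.2 j.2.
Proof.
by rewrite -e_null; apply: eq_dot => a; apply: eq_dot => b; rewrite mxE.
Qed.

Lemma infeld_frame : infeld_vdw G (spin_frame e).
Proof.
split=> [A A' B B'|A A' a]; last by rewrite /spin_frame e_conj.
rewrite !eps_ebool -(e_null (A == 1, A' == 1) (B == 1, B' == 1)) /dot.
apply: eq_bigr => a _; rewrite mulr_sumr; apply: eq_bigr => b _.
by rewrite /spin_frame; ring.
Qed.

Let w := frame4 e (cplx4 W).

Lemma weyl_like_frame_weyl : weyl_like w.
Proof.
apply: (weyl_like_frame4 null).
- by move=> a b c d; rewrite /cplx4 -rmorphN /W weyl_at_anti.
- by move=> a b c d; rewrite /cplx4 /W weyl_at_pair.
- by move=> a b c d; rewrite /cplx4 -!rmorphD /W weyl_at_cyc ?rmorph0.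
- move=> b d;
  rewrite -[RHS](rmorph0 rc) -(weyl_at_trace Rm Gsym Gu b d) rmorph_sum.
  apply: eq_bigr => a _; rewrite rmorph_sum; apply: eq_bigr => c _.
  by rewrite rmorphM -map_invmx mxE.
Qed.

Lemma weyl_scalars_conj n : weyl_scalars (conjW w) n = (weyl_scalars w n)^*.
Proof. by case: n => [|[|[|[|n]]]]; rewrite /weyl_scalars /= conjW_frame4. Qed.

(** As W is real, the scalars of its conjugate are the conjugates of its own. *)
Lemma weyl_scalars_neq0 : (exists a b c d, W a b c d != 0) ->
  exists2 k, (k < 5)%N & weyl_scalars w k != 0.
Proof.
move=> [a [b [c [d Wn]]]]; apply: contrapT => H.
have p0 n : weyl_scalars w n = 0.
  have p5 k : (k < 5)%N -> weyl_scalars w k = 0.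
    by move=> k5; have [//|pk] := eqVneq (weyl_scalars w k) 0; case: H;
      exists k.
  by case: n => [|[|[|[|n]]]];
    [exact: (p5 0)|exact: (p5 1)|exact: (p5 2)|exact: (p5 3)|exact: (p5 4)].
have w0 := weyl_like0 weyl_like_frame_weyl p0.
have W0 : cplx4 W a b c d = 0.
  apply: (frame4_eq0 null); apply: w0 => n.
  by rewrite -/(conjW w) weyl_scalars_conj p0 conjC0.
by move/eqP: Wn; apply; exact: complexI W0.
Qed.

Let A_anti a b c d : cplx2 (curv a b) c d = - cplx2 (curv a b) d c.
Proof. by rewrite /cplx2 -rmorphN /curv Rm_anti12. Qed.

(* [bv a b] is the spinor of the curvature 2-form of the pair [a], [b], and
   [bvc a b] its conjugate. *)
Let bv a b := spinor_of_so (frame2 e (cplx2 (curv a b))).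
Let bvc a b :=
  spinor_of_so (fun i j => frame2 e (cplx2 (curv a b)) (conj_ix i) (conj_ix j)).

Let fr2E a b i j : frame2 e (cplx2 (curv a b)) i j
  = so_of_spinors (bv a b) (bvc a b) i j.
Proof. exact/so_of_spinorsE/frame2_anti. Qed.

Let bvcE a b n : bvc a b n = (bv a b n)^*.
Proof.
rewrite /bvc /bv /spinor_of_so; case: n => [|[|n]]; rewrite /quad.
- exact: conj_frame2.
- by rewrite rmorphM rmorphB fmorphV rmorph_nat /=; congr (_ * (_ - _));
  exact: conj_frame2.
- exact: conj_frame2.
Qed.

Hypothesis W_killed : forall a b, kills4 (endo G (curv a b)) W.

Lemma curv_kills_quartic a b : kills_quartic (bv a b) (weyl_scalars w).
Proof.
apply: (@so_act_kills_quartic _ _ (bvc a b) _ (weyl_scalars (conjW w))) =>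
  i j k l.
have := frame4_inf_act null (cplx4 W) (A_anti a b) i j k l.
have -> : frame4 e (inf_act Gc (cplx2 (curv a b)) (cplx4 W)) i j k l = 0.
  apply: dot0 => c; apply: dot0 => d; apply: dot0 => c'; apply: dot0 => d'.
  exact: inf_actC.
move=> /esym/eqP; rewrite oppr_eq0 => /eqP <-.
by rewrite /so_act /raise /null_contract -!fr2E
  -!(weyl_likeE weyl_like_frame_weyl).
Qed.

Lemma petrov_type_pointwise :
  let Psi := weyl_spinor W (spin_frame e) in
  [\/ spinor_type_D Psi, spinor_type_N Psi | spinor_type_O Psi].
Proof.
have [tO|nO] := pselect (spinor_type_O (weyl_spinor W (spin_frame e)));
  first by constructor 3.
have PsiE := weyl_spinorE weyl_like_frame_weyl.
have [[a [b [c [d PartialDerivatives]]]]|R0] :=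
  pselect (exists a b c d, curv a b c d != 0); last first.
  have Rm0 a b c d : Rm a b c d = 0.
    by have [//|Rn] := eqVneq (Rm a b c d) 0; case: R0; exists c, d, a, b.
  have ric0 b d : ricci_at G Rm b d = 0.
    by rewrite /ricci_at big1 // => a _; rewrite big1 // => m _;
      rewrite Rm0 mulr0.
  have W0 a b c d : W a b c d = 0.
    have S0 : scalar_at G Rm = 0.
      by rewrite /scalar_at big1 // => b' _; rewrite big1 // => d' _;
        rewrite ric0 mulr0.
    by rewrite /W /weyl_at S0 !ric0 Rm0; ring.
  have w0 i j k l : w i j k l = 0.
    apply: dot0 => a; apply: dot0 => b; apply: dot0 => c; apply: dot0 => d.
    by rewrite /cplx4 W0 rmorph0.
  case: nO => A B D E; rewrite PsiE.
  by case: (A + B + D + E)%N => [|[|[|[|n]]]]; exact: w0.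
have bn0 : exists2 k, (k < 3)%N & bv a b k != 0.
  apply: contrapT => H.
  have b0 k : bv a b k = 0.
    have b3 n : (n < 3)%N -> bv a b n = 0.
      by move=> n3; have [//|bn] := eqVneq (bv a b n) 0; case: H; exists n.
    by case: k => [|[|k]]; [exact: (b3 0)|exact: (b3 1)|exact: (b3 2)].
  have A0 : cplx2 (curv a b) c d = 0.
    apply: (frame2_eq0 null) => i j.
    by rewrite fr2E /so_of_spinors bvcE !b0 conjC0 !mul0r addr0.
  by move/eqP: PartialDerivatives; apply; exact: complexI A0.
have [q [q0 q1 q2 q3 q4]] := kills_quartic_square (curv_kills_quartic a b) bn0.
have DN : spinor_type_D (weyl_spinor W (spin_frame e)) \/
          spinor_type_N (weyl_spinor W (spin_frame e)).
  apply: (@square_type _ _ q (bv a b 0%N) (bv a b 1%N) (bv a b 2%N)) =>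
    // A B D E.
  rewrite PsiE /square_quartic.
  by case: (A + B + D + E)%N => [|[|[|[|n]]]].
by case: DN => ?; [constructor 1|constructor 2].
Qed.

Hypothesis W_neq0 : exists a b c d, W a b c d != 0.

(** The curvature endomorphisms commute pairwise. *)
Lemma curv_comm a b a' b' c d :
  \sum_m endo G (curv a b) m c * curv a' b' m d
  + \sum_m endo G (curv a b) m d * curv a' b' c m = 0.
Proof.
have cr := kills_quartic_proportional (curv_kills_quartic a b)
  (curv_kills_quartic a' b') (weyl_scalars_neq0 W_neq0).
have crc : [/\ bvc a b 0%N * bvc a' b' 1%N = bvc a b 1%N * bvc a' b' 0%N,
    bvc a b 0%N * bvc a' b' 2%N = bvc a b 2%N * bvc a' b' 0%N &
    bvc a b 1%N * bvc a' b' 2%N = bvc a b 2%N * bvc a' b' 1%N].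
  by case: cr => h1 h2 h3; rewrite !bvcE -!rmorphM h1 h2 h3.
have := frame2_comm null (A_anti a b) (A_anti a' b').
have E i j :
  raise (frame2 e (cplx2 (curv a b))) i (fun p => frame2 e (cplx2 (curv a' b'))
  p j)
   = raise (frame2 e (cplx2 (curv a' b'))) i
     (fun p => frame2 e (cplx2 (curv a b)) p j).
  have := commute_so_of_spinors cr crc i j.
  by rewrite /raise /null_contract -!fr2E.
move=> /(_ E c d) H; apply: (@complexI R).
rewrite rmorphD !rmorph_sum [RHS]rmorph0 -[RHS]H.
by congr (_ + _); apply: eq_bigr => m _; rewrite endoC rmorphM.
Qed.

Lemma curv_kills_riemann a b : kills4 (endo G (curv a b)) Rm.
Proof.
move=> c d c' d'.
have e1 := curv_comm a b c' d' c d; have e2 := curv_comm a b c d c' d'.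
rewrite /curv in e1 e2 *; rewrite e1 add0r -[RHS]e2.
by congr (_ + _); apply: eq_bigr => n _; rewrite Rm_pair.
Qed.

End Curv.
End PointwiseTheorem.

(** * The theorem in a chart *)

Section Chart.
Variables (R : realType) (M : topologicalType) (S : spacetime R M).
Variables (c : chart R M) (p : M).
Hypotheses (cS : atlas S c) (cp : dom c p).

Local Notation g := (metric S c).
Local Notation x := (coord c p).
Local Notation G := (g x).
Local Notation Rm := (fun a b d e => riemann g a b d e x).

Let Ux : cod c x := coord_cod cp.
Let oU : open (cod c) := @cod_open _ _ c.
Let gs := @metric_smooth _ _ S c cS.
Let glor y (Uy : cod c y) := @metric_lorentzian _ _ S c y cS Uy.
Let gu y (Uy : cod c y) : g y \in unitmx := lorentzian_unit (glor Uy).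
Let gsym y (Uy : cod c y) := @metric_sym _ _ S c y cS Uy.

Let Gsym a b : G a b = G b a.
Proof. exact: (lowerC gsym). Qed.

Let Rm_anti12 a b d e : Rm a b d e = - Rm b a d e.
Proof. exact: (riemann_anti12 oU gs gu gsym). Qed.

Let Rm_pair a b d e : Rm a b d e = Rm d e a b.
Proof. exact: (riemann_pair oU gs gu gsym). Qed.

Let Rm_cyc a b d e : Rm a b d e + Rm a d e b + Rm a e b d = 0.
Proof. exact: (riemann_cyclic oU gsym). Qed.

Let endoE m d a b : riemann_up g m d a b x = endo G (curv Rm a b) m d.
Proof. exact: (riemann_upE gu). Qed.

Let ricciE b d : ricci g b d x = ricci_at G Rm b d.
Proof. by apply: eq_bigr => a _; rewrite (riemann_upE gu). Qed.

Let scalarE : scalar_curvature g x = scalar_at G Rm.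
Proof. by apply: eq_bigr => b _; apply: eq_bigr => d _; rewrite ricciE. Qed.

Let weylE a b d e : weyl g a b d e x = weyl_at G Rm a b d e.
Proof. by rewrite /weyl !ricciE scalarE. Qed.

(** Semi-symmetry at a point is an algebraic condition on the curvature. *)
Lemma semi_symmetric_chartE :
  (forall a b s, alt_nabla2 g (tensor4 (riemann g)) a b s x = 0) <->
  forall a b, kills4 (endo G (curv Rm a b)) Rm.
Proof.
split=> H a b.
  move=> d e f h.
  have := (alt_nabla2_tensor4 oU gs gu gsym a b Ux (smooth_riemann oU gs gu)).1
    (H a b) d e f h.
  move=> E; rewrite -[RHS]E.
  by congr (_ + _ + _ + _); apply: eq_bigr => m _; rewrite endoE.
apply/(alt_nabla2_tensor4 oU gs gu gsym a b Ux (smooth_riemann oU gs gu)) =>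
  d e f h.
rewrite -[RHS](H a b d e f h).
by congr (_ + _ + _ + _); apply: eq_bigr => m _; rewrite endoE.
Qed.

Lemma conformally_semi_symmetric_chartE :
  (forall a b s, alt_nabla2 g (tensor4 (weyl g)) a b s x = 0) <->
  forall a b, kills4 (endo G (curv Rm a b)) (weyl_at G Rm).
Proof.
split=> H a b.
  move=> d e f h.
  have := (alt_nabla2_tensor4 oU gs gu gsym a b Ux (smooth_weyl oU gs gu)).1
    (H a b) d e f h.
  move=> E; rewrite -[RHS]E.
  by congr (_ + _ + _ + _); apply: eq_bigr => m _; rewrite endoE weylE.
apply/(alt_nabla2_tensor4 oU gs gu gsym a b Ux (smooth_weyl oU gs gu)) =>
  d e f h.
rewrite -[RHS](H a b d e f h).
by congr (_ + _ + _ + _); apply: eq_bigr => m _; rewrite endoE weylE.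
Qed.

Let curv_anti a b d e : curv Rm a b d e = - curv Rm a b e d.
Proof. exact: Rm_anti12. Qed.

Lemma kills_riemann_weyl :
  (forall a b, kills4 (endo G (curv Rm a b)) Rm) ->
  forall a b, kills4 (endo G (curv Rm a b)) (weyl_at G Rm).
Proof. by move=> H a b;
  apply: (kills4_weyl Gsym (gu Ux) (curv_anti a b) (H a b)). Qed.

Lemma kills_weyl_riemann : weyl_neq0 S p ->
  (forall a b, kills4 (endo G (curv Rm a b)) (weyl_at G Rm)) ->
  forall a b, kills4 (endo G (curv Rm a b)) Rm.
Proof.
move=> Wn H; have [e [en ec]] := null_frame_exists (glor Ux).
apply: (curv_kills_riemann Gsym (glor Ux) Rm_anti12 Rm_pair Rm_cyc en ec H).
have [i [j [k [l W0]]]] := Wn c cS cp.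
by exists i, j, k, l; rewrite -weylE.
Qed.

Lemma petrov_at : (forall a b, kills4 (endo G (curv Rm a b)) (weyl_at G Rm)) ->
  petrov_D S c p \/ petrov_N S c p \/ petrov_O S c p.
Proof.
move=> H; have [e [en ec]] := null_frame_exists (glor Ux).
have sf := infeld_frame en ec.
have WE : (fun i j k l => weyl g i j k l x) = weyl_at G Rm.
  by apply/funext => i; apply/funext => j; apply/funext => k; apply/funext => l;
    exact: weylE.
have := petrov_type_pointwise Gsym (glor Ux) Rm_anti12 Rm_pair Rm_cyc en ec H.
by move=> /= [D|N|O']; [left|right; left|right; right]; exists (spin_frame e);
  rewrite ?WE.
Qed.
End Chart.

Theorem theorem3 (R : realType) (M : topologicalType) (S : spacetime R M) :
  ((forall p : M, weyl_neq0 S p) ->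
     (conformally_semi_symmetric S <-> semi_symmetric S)) /\
  (semi_symmetric S ->
     forall (p : M) (c : chart R M), atlas S c -> dom c p ->
       petrov_D S c p \/ petrov_N S c p \/ petrov_O S c p).
Proof.
have R2W p c (cS : atlas S c) (cp : dom c p) :=
  @kills_riemann_weyl R M S c p cS cp.
split=> [Wn|ss p c cS cp].
  split=> H p c cS cp.
    apply/(semi_symmetric_chartE cS cp)/kills_weyl_riemann => //.
    by apply/(conformally_semi_symmetric_chartE cS cp) => a b s; exact: H.
  apply/(conformally_semi_symmetric_chartE cS cp)/R2W => //.
  by apply/(semi_symmetric_chartE cS cp) => a b s; exact: H.
apply: petrov_at => //; apply: R2W => //.
by apply/(semi_symmetric_chartE cS cp) => a b s; exact: ss.
Qed.
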